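(* Let $\mathbb{K}$ be a field of characteristic $0$ and let $(A,\mu,\alpha)$ be a hom-associative algebra over $\mathbb{K}$. Then its Hochschild-type cohomology $H^\bullet_\alpha(A,A)$ inherits a Gerstenhaber algebra structure: the cup product $\cup_\alpha$ and the degree $-1$ bracket $[-,-]_\alpha$ on the cochains $C^\bullet_\alpha(A,A)$ induce well-defined operations on $H^\bullet_\alpha(A,A)$, and with these operations $H^\bullet_\alpha(A,A)$ is a Gerstenhaber algebra.
   Context: All vector spaces are over a field $\mathbb{K}$ of characteristic $0$. Hom-associative algebra (always assumed multiplicative): a triple $(A,\mu,\alpha)$ of a vector space $A$, a bilinear map $\mu:A\times A\to A$ and a linear map $\alpha:A\to A$ with $\mu(\alpha(a),\mu(b,c))=\mu(\mu(a,b),\alpha(c))$ and $\alpha(\mu(a,b))=\mu(\alpha(a),\alpha(b))$ for all $a,b,c\in A$. Cohomology: for $n\ge1$, $C^n_\alpha(A,A)$ is the space of multilinear maps $f:A^{\otimes n}\to A$ with $\alpha\circ f=f\circ\alpha^{\otimes n}$. The coboundary $\delta_\alpha:C^n_\alpha(A,A)\to C^{n+1}_\alpha(A,A)$ is $$(\delta_\alpha f)(a_1,\dots,a_{n+1})=\mu(\alpha^{n-1}(a_1),f(a_2,\dots,a_{n+1}))+\sum_{i=1}^n(-1)^i f(\alpha(a_1),\dots,\alpha(a_{i-1}),\mu(a_i,a_{i+1}),\alpha(a_{i+2}),\dots,\alpha(a_{n+1}))+(-1)^{n+1}\mu(f(a_1,\dots,a_n),\alpha^{n-1}(a_{n+1})),$$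 and $\delta_\alpha^2=0$. For $n\ge2$, $H^n_\alpha(A,A)=\ker(\delta_\alpha|_{C^n_\alpha(A,A)})/\delta_\alpha(C^{n-1}_\alpha(A,A))$, and $H^\bullet_\alpha(A,A)=\bigoplus_{n\ge2}H^n_\alpha(A,A)$. Cup product: for $f\in C^m_\alpha(A,A)$, $g\in C^n_\alpha(A,A)$, $f\cup_\alpha g\in C^{m+n}_\alpha(A,A)$ is $$(f\cup_\alpha g)(a_1,\dots,a_{m+n})=\mu\big(f(\alpha^{n-1}a_1,\dots,\alpha^{n-1}a_m),\,g(\alpha^{m-1}a_{m+1},\dots,\alpha^{m-1}a_{m+n})\big).$$ Bracket: for $f\in C^m_\alpha(A,A)$, $g\in C^n_\alpha(A,A)$, $[f,g]_\alpha=f\circ g-(-1)^{(m-1)(n-1)}g\circ f\in C^{m+n-1}_\alpha(A,A)$, where $$(f\circ g)(a_1,\dots,a_{m+n-1})=\sum_{i=1}^m(-1)^{(n-1)(i-1)}f(\alpha^{n-1}a_1,\dots,\alpha^{n-1}a_{i-1},g(a_i,\dots,a_{i+n-1}),\alpha^{n-1}a_{i+n},\dots,\alpha^{n-1}a_{m+n-1}).$$ Gerstenhaber algebra (right version): a graded commutative associative algebra $(\mathcal{A}=\bigoplus_i\mathcal{A}^i,\cup)$ (no unit required; graded commutative means $a\cup b=(-1)^{|a||b|}b\cup a$) with a degree $-1$ graded Lie bracket $[-,-]:\mathcal{A}^i\times\mathcal{A}^j\to\mathcal{A}^{i+j-1}$, i.e. $[a,b]=-(-1)^{(|a|-1)(|b|-1)}[b,a]$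 and $[a,[b,c]]=[[a,b],c]+(-1)^{(|a|-1)(|b|-1)}[b,[a,c]]$, such that $[a\cup b,c]=[a,c]\cup b+(-1)^{(|c|-1)|a|}a\cup[b,c]$ for all homogeneous $a,b,c$. *)

(* Defs.v *)
From HB Require Import structures.
From mathcomp Require Import all_boot all_order all_algebra.
From mathcomp Require Import boolp functions.

Set Implicit Arguments.
Unset Strict Implicit.
Unset Printing Implicit Defensive.

Import GRing.Theory.
Local Open Scope ring_scope.
Local Open Scope quotient_scope.

(* MathComp's [{ideal_quot U}] is only a [zmodType]; we add the scaling. *)
Section ModuleQuotient.
Variables (K : pzRingType) (V : lmodType K) (U : submodClosed V).

Definition submod_zmod : {pred V} := U.
HB.instance Definition _ := GRing.isZmodClosed.Build V submod_zmod
  (GRing.submod_closedB (submodClosedP U)).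

Definition module_quot := {ideal_quot submod_zmod}.
HB.instance Definition _ := GRing.Zmodule.on module_quot.

Definition module_proj (x : V) : module_quot := \pi_({ideal_quot submod_zmod}) x.

Definition module_quot_scale (c : K) (x : module_quot) : module_quot :=
  module_proj (c *: repr x).

Lemma module_proj_eq (x y : V) :
  (module_proj x = module_proj y) <-> (x - y \in U).
Proof.
have -> : (x - y \in U) = (module_proj x == module_proj y).
  exact: (Quotient.idealrBE submod_zmod).
by split=> /eqP.
Qed.

Lemma module_proj_surj (x : module_quot) : exists y, module_proj y = x.
Proof. by exists (repr x); rewrite /module_proj reprK. Qed.

Lemma module_projD (x y : V) :
  module_proj (x + y) = module_proj x + module_proj y.
Proof. exact: (raddfD (\pi_({ideal_quot submod_zmod}))). Qed.

Lemma module_projZ (c : K) (x : V) :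
  module_proj (c *: x) = module_quot_scale c (module_proj x).
Proof.
apply/module_proj_eq; rewrite -scalerBr rpredZ//; apply/module_proj_eq.
by rewrite /module_proj reprK.
Qed.

Fact module_quot_scaleA a b v :
  module_quot_scale a (module_quot_scale b v) = module_quot_scale (a * b) v.
Proof.
by have [x <-] := module_proj_surj v; rewrite -!module_projZ scalerA.
Qed.

Fact module_quot_scale1 : left_id 1 module_quot_scale.
Proof.
by move=> v; have [x <-] := module_proj_surj v; rewrite -module_projZ scale1r.
Qed.

Fact module_quot_scaleDr : right_distributive module_quot_scale +%R.
Proof.
move=> a v w; have [x <-] := module_proj_surj v.
have [y <-] := module_proj_surj w.
by rewrite -module_projD -!module_projZ scalerDr module_projD.
Qed.

Fact module_quot_scaleDl v :
  {morph module_quot_scale^~ v : a b / a + b >-> a + b}.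
Proof.
move=> a b /=; have [x <-] := module_proj_surj v.
by rewrite -!module_projZ scalerDl module_projD.
Qed.

HB.instance Definition _ := GRing.Zmodule_isLmodule.Build K module_quot
  module_quot_scaleA module_quot_scale1 module_quot_scaleDr module_quot_scaleDl.

Fact module_proj_linear : linear module_proj.
Proof. by move=> c x y; rewrite module_projD module_projZ. Qed.

HB.instance Definition _ :=
  GRing.isLinear.Build K V module_quot *:%R module_proj module_proj_linear.

End ModuleQuotient.

(* A graded vector space (+)_i A^i is given by the family of its homogeneous
   components.  The components in which the two sides of an identity live have
   propositionally equal degrees; [ecast] transports along these equalities. *)
Section DegreeEquations.
Variables i j k : int.

Fact deg_bracketC : j + i - 1 = i + j - 1.
Proof. by rewrite (addrC i). Qed.

Fact deg_jacobi_l : (i + j - 1) + k - 1 = i + (j + k - 1) - 1.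
Proof. by rewrite (addrAC _ (-1)) !addrA. Qed.

Fact deg_jacobi_r : j + (i + k - 1) - 1 = i + (j + k - 1) - 1.
Proof. by rewrite !addrA (addrC i j). Qed.

Fact deg_leibniz_l : (i + k - 1) + j = (i + j) + k - 1.
Proof. by rewrite addrAC (addrAC i). Qed.

Fact deg_leibniz_r : i + (j + k - 1) = (i + j) + k - 1.
Proof. by rewrite !addrA. Qed.

End DegreeEquations.

(* No unit is required, and |a| is the degree of the component of a. *)
Record is_gerstenhaber (K : fieldType) (G : int -> lmodType K)
    (cup : forall i j, G i -> G j -> G (i + j))
    (br : forall i j, G i -> G j -> G (i + j - 1)) : Prop := IsGerstenhaber {
  cup_bilinear : forall i j, bilinear_for *:%R *:%R (@cup i j);
  cup_assoc : forall i j k (a : G i) (b : G j) (c : G k),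
    ecast d (G d) (addrA i j k) (cup _ _ a (cup _ _ b c))
    = cup _ _ (cup _ _ a b) c;
  cup_gradedC : forall i j (a : G i) (b : G j),
    cup _ _ a b
    = (-1) ^ (i * j) *: ecast d (G d) (addrC j i) (cup _ _ b a);
  bracket_bilinear : forall i j, bilinear_for *:%R *:%R (@br i j);
  bracket_antisym : forall i j (a : G i) (b : G j),
    br _ _ a b
    = - ((-1) ^ ((i - 1) * (j - 1))
           *: ecast d (G d) (deg_bracketC i j) (br _ _ b a));
  bracket_jacobi : forall i j k (a : G i) (b : G j) (c : G k),
    br _ _ a (br _ _ b c)
    = ecast d (G d) (deg_jacobi_l i j k) (br _ _ (br _ _ a b) c)
      + (-1) ^ ((i - 1) * (j - 1))
          *: ecast d (G d) (deg_jacobi_r i j k) (br _ _ b (br _ _ a c));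
  bracket_leibniz : forall i j k (a : G i) (b : G j) (c : G k),
    br _ _ (cup _ _ a b) c
    = ecast d (G d) (deg_leibniz_l i j k) (cup _ _ (br _ _ a c) b)
      + (-1) ^ ((k - 1) * i)
          *: ecast d (G d) (deg_leibniz_r i j k) (cup _ _ a (br _ _ b c))
}.

Definition hom_associative (K : fieldType) (A : lmodType K)
    (mu : {bilinear A -> A -> A}) (alpha : {linear A -> A}) : Prop :=
  (forall a b c, mu (alpha a) (mu b c) = mu (mu a b) (alpha c))
  /\ (forall a b, alpha (mu a b) = mu (alpha a) (alpha b)).

Section HomCohomology.
Variables (K : fieldType) (A : lmodType K).
Variables (mu : {bilinear A -> A -> A}) (alpha : {linear A -> A}).

(* A map A^n -> A is a function of tuples; entries are numbered from 0, so that
   the argument a_(i+1) of the usual formulas is [a`_i]. *)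

Definition multilinear n (f : n.-tuple A -> A) : Prop :=
  forall (a : n.-tuple A) (i : 'I_n),
    linear (fun x => f [tuple if k == i then x else a`_k | k < n]).

(* The space C^n, for n >= 1; degree 0 is never used. *)
Definition cochain n : {pred n.-tuple A -> A} := fun f =>
  `[< multilinear f
      /\ forall a : n.-tuple A, alpha (f a) = f [tuple alpha a`_k | k < n] >].
Arguments cochain : clear implicits.

Definition coboundary n (f : n.-tuple A -> A) (a : n.+1.-tuple A) : A :=
  mu (iter n.-1 alpha a`_0) (f [tuple a`_k.+1 | k < n])
  + \sum_(i < n) (-1) ^+ i.+1 *:
      f [tuple if (k < i)%N then alpha a`_k
               else if k == i then mu a`_k a`_k.+1
               else alpha a`_k.+1 | k < n]
  + (-1) ^+ n.+1 *: mu (f [tuple a`_k | k < n]) (iter n.-1 alpha a`_n).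

Definition cup_cochain m n (f : m.-tuple A -> A) (g : n.-tuple A -> A)
    (a : (m + n).-tuple A) : A :=
  mu (f [tuple iter n.-1 alpha a`_k | k < m])
     (g [tuple iter m.-1 alpha a`_(m + k)%N | k < n]).

Definition circ_cochain m n (f : m.-tuple A -> A) (g : n.-tuple A -> A)
    (a : (m + n).-1.-tuple A) : A :=
  \sum_(i < m) (-1) ^+ (n.-1 * i) *:
    f [tuple if (k < i)%N then iter n.-1 alpha a`_k
             else if k == i then g [tuple a`_(i + l)%N | l < n]
             else iter n.-1 alpha a`_(k + n.-1)%N | k < m].

Fact circ_arity m n : (m + n).-1 = (n + m).-1.
Proof. by rewrite addnC. Qed.

Definition bracket_cochain m n (f : m.-tuple A -> A) (g : n.-tuple A -> A)
    (a : (m + n).-1.-tuple A) : A :=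
  circ_cochain f g a
  - (-1) ^+ (m.-1 * n.-1) *:
      circ_cochain g f (tcast (circ_arity m n) a).

Definition cocycle n : {pred n.-tuple A -> A} := fun f =>
  (f \in cochain n) && `[< forall a, coboundary f a = 0 >].
Arguments cocycle : clear implicits.

Lemma cochainP n (f : n.-tuple A -> A) :
  reflect (multilinear f
           /\ forall a : n.-tuple A, alpha (f a) = f [tuple alpha a`_k | k < n])
          (f \in cochain n).
Proof. exact: asboolP. Qed.

Lemma cocycleP n (f : n.-tuple A -> A) :
  reflect (f \in cochain n /\ forall a, coboundary f a = 0) (f \in cocycle n).
Proof.
by apply: (iffP andP) => -[fC df]; split=> //; apply/asboolP.
Qed.

Fact fct_linE n c (f g : n.-tuple A -> A) a :
  (c *: f + g) a = c *: f a + g a.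
Proof. by []. Qed.

Fact cochain_submod n : submod_closed (cochain n).
Proof.
split=> [|c f g /cochainP[fl fa] /cochainP[gl ga]]; apply/cochainP.
  split=> [a i c x y|a]; last exact: linear0.
  by rewrite [RHS]addr0 [RHS]scaler0.
split=> [a i d x y|a]; rewrite !fct_linE; last by rewrite linearP fa ga.
rewrite fl gl !scalerDr -!addrA; congr (_ + _); first by rewrite !scalerA mulrC.
by rewrite addrCA.
Qed.

Fact coboundary_linear n : linear (@coboundary n).
Proof.
move=> c f g; apply/funext => a; rewrite fct_linE /coboundary.
under eq_bigr do rewrite fct_linE scalerDr scalerA mulrC -scalerA.
rewrite big_split /= -scaler_sumr !fct_linE linearPr linearPl /=.
rewrite !scalerDr !scalerA (mulrC _ c) -!addrA; congr (_ + _).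
rewrite addrCA; congr (_ + _); rewrite [RHS]addrCA; congr (_ + _).
by rewrite addrCA.
Qed.

Fact cocycle_submod n : submod_closed (cocycle n).
Proof.
have [c0 cZ] := cochain_submod n.
have dP := @coboundary_linear n.
split=> [|c f g /cocycleP[fC df] /cocycleP[gC dg]]; apply/cocycleP.
  split=> // a; rewrite -[X in coboundary X](addNr 0) -scaleN1r.
  by rewrite dP fct_linE scaleN1r addNr.
split=> [|a]; first exact: cZ.
by rewrite dP fct_linE df dg scaler0 addr0.
Qed.

HB.instance Definition _ n :=
  GRing.isSubmodClosed.Build K (n.-tuple A -> A) (cocycle n) (cocycle_submod n).

Definition cocycle_space n := {f : n.-tuple A -> A | f \in cocycle n}.
HB.instance Definition _ n := Choice.on (cocycle_space n).
HB.instance Definition _ n := SubType.on (cocycle_space n).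
HB.instance Definition _ n := [SubChoice_isSubLmodule of cocycle_space n by <:].

(* The subspace delta (C^n) of Z^(n+1).  It is defined as an intersection with
   Z^(n+1), which is all of delta (C^n) when mu is hom-associative. *)
Definition coboundaries n : {pred cocycle_space n.+1} := fun z =>
  `[< exists2 g, g \in cochain n & val z = coboundary g >].
Arguments coboundaries : clear implicits.

Fact coboundaries_submod n : submod_closed (coboundaries n).
Proof.
have [c0 cZ] := cochain_submod n; have dP := @coboundary_linear n.
split=> [|c x y /asboolP[f fC xE] /asboolP[g gC yE]]; apply/asboolP.
  exists 0 => //; rewrite -[X in coboundary X](addNr 0) -scaleN1r dP.
  by rewrite scaleN1r addNr.
by exists (c *: f + g); rewrite ?cZ// dP -xE -yE.
Qed.

HB.instance Definition _ n :=
  GRing.isSubmodClosed.Build K (cocycle_space n.+1) (coboundaries n)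
    (coboundaries_submod n).

(* H^i = ker delta / im delta in degrees i >= 2, and 0 in the other degrees. *)
Definition cohomology (i : int) : lmodType K :=
  match i with
  | Posz n.+2 => module_quot (coboundaries n.+1)
  | _ => 'rV[K]_0
  end.

(* The cohomology class of an n-cocycle f, for n >= 2; it has the dummy value
   0 when f is not a cocycle. *)
Definition cohomology_class n : (n.-tuple A -> A) -> cohomology n :=
  match n return (n.-tuple A -> A) -> cohomology n with
  | k.+2 => fun f => module_proj (coboundaries k.+1) (insubd 0 f)
  | _ => fun=> 0
  end.

Lemma cohomology_class_eq n (f g : n.+2.-tuple A -> A) :
  f \in cocycle n.+2 -> g \in cocycle n.+2 ->
  cohomology_class f = cohomology_class g
  <-> exists2 h, h \in cochain n.+1 & f - g = coboundary h.
Proof.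
move=> fZ gZ /=.
set x := insubd _ f; set y := insubd _ g.
have xE : val x = f by rewrite /x val_insubd fZ.
have yE : val y = g by rewrite /y val_insubd gZ.
rewrite module_proj_eq; split=> [/asboolP[h hC]|[h hC e]].
  by rewrite raddfB /= xE yE; exists h.
by apply/asboolP; exists h; rewrite // raddfB /= xE yE.
Qed.

Lemma cohomology_class_surj n (x : cohomology n.+2) :
  exists2 f, f \in cocycle n.+2 & cohomology_class f = x.
Proof.
have [z <-] := module_proj_surj x.
by exists (val z); [exact: valP | rewrite /= valKd].
Qed.

End HomCohomology.

Arguments cochain {K A} alpha n _.
Arguments cocycle {K A} mu alpha n _.
Arguments coboundaries {K A} mu alpha n _.
Arguments coboundary {K A} mu alpha {n} f a.
Arguments cup_cochain {K A} mu alpha {m n} f g a.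
Arguments circ_cochain {K A} alpha {m n} f g a.
Arguments bracket_cochain {K A} alpha {m n} f g a.
Arguments cohomology {K A} mu alpha i.
Arguments cohomology_class {K A} mu alpha {n} f.

Fact bracket_degree m n : (2 <= m)%N -> (m + n).-1%:Z = m%:Z + n%:Z - 1.
Proof. by case: m => // m _; rewrite addSn /= -PoszD addSn intS addrAC subrr add0r. Qed.

(* Main.v *)
From HB Require Import structures.
Require Import Defs.
From mathcomp Require Import all_boot all_order all_algebra.
From mathcomp Require Import boolp functions zify.

Set Implicit Arguments.
Unset Strict Implicit.
Unset Printing Implicit Defensive.

Import GRing.Theory.
Local Open Scope ring_scope.

(** The multilinear maps A^n -> A that commute with alpha form a nonsymmetric
    operad: the i-th partial composition of f with an n-ary g inserts
    g(a_i, ...) into the i-th slot of f and applies alpha^(n-1) to the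
    remaining arguments.
    Multiplicativity puts mu in this operad, and hom-associativity says exactly
    that the two partial compositions of mu with itself agree.  The twisted
    coboundary, cup product and bracket are the ones that any operad with such
    a multiplication carries ([on_tuples_cobd], [on_tuples_cup],
    [on_tuples_bracket]).  Once the operad axioms are verified ([hom_operad]),
    the theorem becomes the one of Gerstenhaber and Voronov for operads with
    multiplication.

    In such an operad, associativity of the cup product ([cup_assoc]), the
    derivation property of the coboundary ([cobd_cup], [cobd_bracket]) and the
    Jacobi identity ([jacobi]) hold for cochains; the last one because the
    associator of the composition product is graded symmetric in its last two
    arguments ([circ_associator]).  Graded commutativity and the Leibniz rule
    hold up to coboundaries only.  The homotopies are f o g and the brace
    h{f, g}, the signed sum of all simultaneous insertions of f and g
    into h with f on the left of g.

    Everything that involves the coboundary comes from one formula,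
    [cobd_comp].  Write delta h as the alternating sum of the faces of h, and
    let S_i h be the sum of the first i + 1 terms.  The coboundary of a single
    partial composition of cocycles is
      delta (h o_i f) = S_(i+1) h o_(i+1) f -+ S_i h o_i f,
    so that a signed sum over i telescopes and leaves its two end terms, which
    are the two cup products of f and h ([cobd_circ]).  For the brace, a double
    sum over i < j telescopes in each index ([cobd_brace]); the end terms are
    cup products with a composite, and the terms on the diagonal j = i + 1 add
    up to the composite of h with the cup product of f and g.

    Throughout, operadic degrees are shifted: degree n means arity n + 1. *)

(** * Equalities in abelian groups *)

(** The graded identities below reduce, once the parities of the degrees are
    fixed, to equalities between sums of terms +- x in an abelian group.  These
    are decided by reflection: both sides are linear forms in the atoms. *)
Inductive zexpr := ZVar of nat | ZZero | ZOpp of zexpr | ZAdd of zexpr & zexpr.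

Fixpoint zcoef (e : zexpr) (i : nat) : int :=
  match e with
  | ZVar j => (i == j)%:Z
  | ZZero => 0
  | ZOpp e => - zcoef e i
  | ZAdd e1 e2 => zcoef e1 i + zcoef e2 i
  end.

Section ZmodReflection.
Variable V : zmodType.

Fixpoint zeval (env : seq V) (e : zexpr) : V :=
  match e with
  | ZVar j => env`_j
  | ZZero => 0
  | ZOpp e => - zeval env e
  | ZAdd e1 e2 => zeval env e1 + zeval env e2
  end.

Lemma zeval_coef env e :
  zeval env e = \sum_(i < size env) env`_i *~ zcoef e i.
Proof.
elim: e => [j||e IH|e1 IH1 e2 IH2] /=.
- have [lt_j|ge_j] := ltnP j (size env).
    rewrite (bigD1 (Ordinal lt_j)) //= eqxx big1 ?addr0 // => i.
    by rewrite -val_eqE /= => /negPf ->.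
  rewrite nth_default // big1 // => i _.
  by rewrite (ltn_eqF (leq_trans (ltn_ord i) ge_j)).
- by rewrite big1.
- by rewrite IH -sumrN; apply: eq_bigr => i _; rewrite mulrNz.
- by rewrite IH1 IH2 -big_split; apply: eq_bigr => i _; rewrite mulrzDr.
Qed.

Lemma zeval_eq env e1 e2 :
  all (fun i => zcoef e1 i == zcoef e2 i) (iota 0 (size env)) ->
  zeval env e1 = zeval env e2.
Proof.
move=> /allP e12; rewrite !zeval_coef; apply: eq_bigr => i _.
by rewrite (eqP (e12 i _)) // mem_iota ltn_ord.
Qed.

End ZmodReflection.

Ltac zenv_add l t :=
  let rec mem l' :=
    lazymatch l' with
    | nil => constr:(false)
    | t :: _ => constr:(true)
    | _ :: ?l'' => mem l''
    end in
  lazymatch mem l with true => l | false => constr:(t :: l) end.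
Ltac zenv l t :=
  lazymatch t with
  | (?a + ?b)%R => let l1 := zenv l a in zenv l1 b
  | (- ?a)%R => zenv l a
  | 0%R => l
  | _ => zenv_add l t
  end.
Ltac zindex l t :=
  lazymatch l with
  | t :: _ => constr:(0%N)
  | _ :: ?l' => let n := zindex l' t in constr:(S n)
  end.
Ltac zreify l t :=
  lazymatch t with
  | (?a + ?b)%R =>
      let ea := zreify l a in let eb := zreify l b in constr:(ZAdd ea eb)
  | (- ?a)%R => let ea := zreify l a in constr:(ZOpp ea)
  | 0%R => constr:(ZZero)
  | _ => let n := zindex l t in constr:(ZVar n)
  end.
Ltac abelian :=
  lazymatch goal with
  | |- @eq ?T ?x ?y =>
      let l0 := zenv (@nil T) x in
      let l := zenv l0 y in
      let ex := zreify l x in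
      let ey := zreify l y in
      refine (@zeval_eq _ l ex ey _); vm_compute; reflexivity
  end.

Section Signs.
Variables (K : pzRingType) (V : lmodType K).

(** Writing a sign as a conditional on a parity makes every product of signs
    computable after a case analysis on the parities of the degrees. *)
Lemma scale_sign n (x : V) :
  (-1) ^+ n *: x = if odd n then - x else x.
Proof. by rewrite -signr_odd; case: odd; rewrite ?scaleN1r ?scale1r. Qed.

End Signs.

Ltac split_parities :=
  rewrite ?scale_sign ?(oddD, oddM, oddS) /=;
  repeat (match goal with |- context [odd ?n] => case: (odd n) end);
  rewrite /=.
Ltac abelian_signs := split_parities; abelian.

(** * Operads with multiplication *)

Section Sums.
Variable V : zmodType.

Lemma exchange_big_triangle n (F : nat -> nat -> V) :
  \sum_(0 <= i < n) \sum_(i.+1 <= j < n) F i j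
  = \sum_(0 <= j < n) \sum_(0 <= i < j) F i j.
Proof.
under eq_big_nat => i /andP[_ lt_in].
  rewrite (big_nat_widenl _ 0%N) //; over.
under [RHS]eq_big_nat => j /andP[_ lt_jn].
  rewrite (big_nat_widen _ _ n) 1?ltnW //; over.
by rewrite (exchange_big_dep_nat xpredT).
Qed.

End Sums.

(** Bundles a map with a proof of linearity, to use the theory of linear maps
    for a map that is linear only under hypotheses on its parameters. *)
Definition linear_pack (K : pzRingType) (V W : lmodType K) (phi : V -> W)
    (lphi : linear phi) : {linear V -> W} :=
  HB.pack phi (GRing.isLinear.Build K V W *:%R phi lphi).

(** All arities share one carrier V, with C n the subspace of operations of
    degree n (arity n + 1).  This way the associativity laws are equations in V,
    without transport along equalities of degrees.  The composite
    [comp n i f g] inserts g, of degree n, into slot i of f; slots are numbered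
    from 0, so an operation of degree m has slots 0, ..., m. *)
Record operad_with_multiplication (K : pzRingType) (V : lmodType K)
    (C : nat -> submodClosed V) (comp : nat -> nat -> V -> V -> V) (mu : V)
    : Prop := OperadWithMultiplication {
  comp_closed : forall m n i f g, f \in C m -> g \in C n -> (i <= m)%N ->
    comp n i f g \in C (m + n)%N;
  comp_linearl : forall n i g, linear (fun f => comp n i f g);
  comp_linearr : forall m n i f, f \in C m -> (i <= m)%N ->
    linear (comp n i f);
  comp_seq : forall n p i j f g h, (j <= n)%N ->
    comp p (i + j)%N (comp n i f g) h = comp (n + p)%N i f (comp p j g h);
  comp_par : forall n p i k f g h, g \in C n -> h \in C p -> (i < k)%N ->
    comp p (k + n)%N (comp n i f g) h = comp n i (comp p k f h) g;
  mult_closed : mu \in C 1%N;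
  mult_assoc : comp 1%N 0%N mu mu = comp 1%N 1%N mu mu
}.

Section Operad.
Variables (K : fieldType) (V : lmodType K) (C : nat -> submodClosed V).
Variables (comp : nat -> nat -> V -> V -> V) (mu : V).
Hypothesis P : operad_with_multiplication C comp mu.

Local Notation "f \o_[ n , i ] g" := (comp n i f g)
  (at level 40, n at next level, i at next level, left associativity,
   format "f  \o_[ n ,  i ]  g").

Lemma compDl n i g : {morph (comp n i)^~ g : x y / x + y}.
Proof. exact: (linearD (linear_pack (comp_linearl P n i g))). Qed.
Lemma compBl n i g : {morph (comp n i)^~ g : x y / x - y}.
Proof. exact: (linearB (linear_pack (comp_linearl P n i g))). Qed.
Lemma comp0l n i g : 0 \o_[n, i] g = 0.
Proof. exact: (linear0 (linear_pack (comp_linearl P n i g))). Qed.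
Lemma compZl n i g c f : (c *: f) \o_[n, i] g = c *: (f \o_[n, i] g).
Proof. exact: (linearZZ (linear_pack (comp_linearl P n i g))). Qed.
Lemma comp_suml n i g I r (Q : pred I) F :
  (\sum_(j <- r | Q j) F j) \o_[n, i] g
  = \sum_(j <- r | Q j) F j \o_[n, i] g.
Proof. exact: (linear_sum (linear_pack (comp_linearl P n i g))). Qed.

Section RightLinearity.
Variables (m n i : nat) (f : V) (fC : f \in C m) (le_im : (i <= m)%N).

Lemma compDr : {morph comp n i f : x y / x + y}.
Proof. exact: (linearD (linear_pack (comp_linearr P n fC le_im))). Qed.
Lemma comp0r : f \o_[n, i] 0 = 0.
Proof. exact: (linear0 (linear_pack (comp_linearr P n fC le_im))). Qed.
Lemma compZr c g : f \o_[n, i] (c *: g) = c *: (f \o_[n, i] g).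
Proof. exact: (linearZZ (linear_pack (comp_linearr P n fC le_im))). Qed.
Lemma comp_sumr I r (Q : pred I) F :
  f \o_[n, i] (\sum_(j <- r | Q j) F j)
  = \sum_(j <- r | Q j) f \o_[n, i] F j.
Proof. exact: (linear_sum (linear_pack (comp_linearr P n fC le_im))). Qed.

End RightLinearity.

(** The signs are those of Gerstenhaber's right pre-Lie product: inserting g
    past i arguments of f costs the shifted degree n of g times i. *)
Definition circ m n f g :=
  \sum_(0 <= i < m.+1) (-1) ^+ (n * i) *: (f \o_[n, i] g).
Definition bracket m n f g := circ m n f g - (-1) ^+ (m * n) *: circ n m g f.
Definition cup m n f g := (mu \o_[n, 1] g) \o_[m, 0] f.
(** The faces of the cosimplicial object whose alternating sum is the Hochschild
    coboundary: multiplication on the left, of two adjacent arguments, and on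
    the right. *)
Definition face p k h :=
  if k isn't k'.+1 then mu \o_[p, 1] h
  else if (k' <= p)%N then h \o_[1, k'] mu else mu \o_[p, 0] h.
(** Partial sums of the coboundary: they carry all the telescoping below. *)
Definition face_sum p i h := \sum_(0 <= k < i.+1) (-1) ^+ k *: face p k h.
Definition cobd p h := face_sum p p.+2 h.
(** The brace f{g, h}: g goes to the left of h.  Inserting h first leaves the
    slots to its left in place, so that g keeps its slot number i. *)
Definition brace m n p f g h :=
  \sum_(0 <= j < m.+1) \sum_(0 <= i < j)
    (-1) ^+ (n * i + p * j) *: ((f \o_[p, j] h) \o_[n, i] g).

Let muC := mult_closed P.

Lemma face_last p h : face p p.+2 h = mu \o_[p, 0] h.
Proof. by rewrite /= ltnn. Qed.

Lemma face_inner p k h : (k <= p)%N -> face p k.+1 h = h \o_[1, k] mu.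
Proof. by move=> /= ->. Qed.

(** The faces of a composite h o_i f are of three kinds: those of h on the left
    of slot i (which move f one slot to the right), those inside f, and those
    of h on the right of slot i. *)
Lemma face_comp_lt p m i k h f : f \in C m -> (i <= p)%N -> (k <= i)%N ->
  face (p + m) k (h \o_[m, i] f) = face p k h \o_[m, i.+1] f.
Proof.
move=> fC le_ip; case: k => [_|k lt_ki]; first by rewrite /= -(comp_seq P).
rewrite !face_inner ?(leq_trans (ltnW lt_ki)) ?(leq_trans le_ip) ?leq_addr //.
by rewrite -(comp_par P h muC fC lt_ki) addn1.
Qed.

Lemma face_comp_mid p m i l h f : (i <= p)%N -> (l <= m)%N ->
  face (p + m) (i + l).+1 (h \o_[m, i] f) = h \o_[m.+1, i] face m l.+1 f.
Proof.
move=> le_ip le_lm; rewrite !face_inner ?leq_add //.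
by rewrite (comp_seq P) ?addn1.
Qed.

Lemma face_comp_gt p m i k h f :
  f \in C m -> (i <= p)%N -> (i.+1 < k <= p.+2)%N ->
  face (p + m) (k + m) (h \o_[m, i] f) = face p k h \o_[m, i] f.
Proof.
move=> fC le_ip; case: k => // k /andP[lt_ik].
rewrite ltnS leq_eqVlt => /orP[/eqP ->|le_kp].
  by rewrite !addSn !face_last -{2}[i]add0n (comp_seq P).
by rewrite addSn !face_inner ?leq_add2r // (comp_par P).
Qed.

(** The two outer faces of f, inserted into h, multiply f by the argument of h
    next to it; they are the composites of f with the face of h that splits
    slot i.  The faces inside f thus supply the term that h lacks. *)
Lemma comp_face_first p m i h f : (i <= p)%N ->
  h \o_[m.+1, i] face m 0 f = face p i.+1 h \o_[m, i.+1] f.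
Proof. by move=> le_ip; rewrite face_inner //= -[i.+1]addn1 (comp_seq P). Qed.

Lemma comp_face_last p m i h f : (i <= p)%N ->
  h \o_[m.+1, i] face m m.+2 f = face p i.+1 h \o_[m, i] f.
Proof.
by move=> le_ip; rewrite face_last face_inner // -{2}[i]addn0 (comp_seq P).
Qed.

Lemma cobdE p h : cobd p h = mu \o_[p, 1] h
  + \sum_(i < p.+1) (-1) ^+ i.+1 *: (h \o_[1, i] mu)
  + (-1) ^+ p.+2 *: (mu \o_[p, 0] h).
Proof.
rewrite /cobd /face_sum big_nat_recl // big_nat_recr // face_last.
rewrite expr0 scale1r addrA big_mkord; congr (_ + _ + _).
by apply: eq_bigr => i _; rewrite face_inner // -ltnS.
Qed.

Lemma face_sumS p i h :
  face_sum p i.+1 h = face_sum p i h + (-1) ^+ i.+1 *: face p i.+1 h.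
Proof. by rewrite /face_sum big_nat_recr. Qed.

Lemma face_sum_comp p m i k h f : f \in C m -> (i <= p)%N -> (k <= i)%N ->
  face_sum (p + m) k (h \o_[m, i] f) = face_sum p k h \o_[m, i.+1] f.
Proof.
move=> fC le_ip le_ki; rewrite comp_suml; apply: eq_big_nat => l /andP[_ lt_lk].
by rewrite compZl face_comp_lt // (leq_trans _ le_ki).
Qed.

(** The inner faces of f are delta f minus its two outer faces, and these extend
    the sums over the faces of h on the left and on the right of slot i by one
    term each.  When f and h are cocycles, only partial sums at i + 1 and i
    remain, with opposite roles: this is what makes sums over i telescope. *)
Lemma cobd_comp p m i h f : h \in C p -> f \in C m -> (i <= p)%N ->
  cobd (p + m) (h \o_[m, i] f)
  = face_sum p i.+1 h \o_[m, i.+1] f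
    + (-1) ^+ m *: ((cobd p h - face_sum p i h) \o_[m, i] f)
    + (-1) ^+ i *: (h \o_[m.+1, i] cobd m f).
Proof.
move=> hC fC le_ip.
have cobd_f : cobd m f = face m 0 f
    + \sum_(0 <= l < m.+1) (-1) ^+ l.+1 *: face m l.+1 f
    + (-1) ^+ m *: face m m.+2 f.
  rewrite /cobd /face_sum big_nat_recr //= big_nat_recl // expr0 scale1r.
  by rewrite -signr_odd /= negbK signr_odd.
have cobd_h : cobd p h - face_sum p i h =
    (-1) ^+ i.+1 *: face p i.+1 h
    + \sum_(i.+2 <= k < p.+3) (-1) ^+ k *: face p k h.
  rewrite /cobd {1}/face_sum (@big_cat_nat _ _ _ i.+1) ?ltnS //=; last by lia.
  by rewrite addrAC subrr add0r big_ltn //; lia.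
rewrite cobd_f cobd_h face_sumS.
rewrite {1}/cobd {1}/face_sum (@big_cat_nat _ _ _ i.+1) //=; last by lia.
rewrite (@big_cat_nat _ _ _ (i.+2 + m) i.+1) //=; try lia.
rewrite -/(face_sum _ _ _) face_sum_comp //.
set S1 := face_sum p i h.
(* The faces inside f. *)
have -> : \sum_(i.+1 <= k < i.+2 + m)
      (-1) ^+ k *: face (p + m) k (h \o_[m, i] f)
    = (-1) ^+ i *: (h \o_[m.+1, i]
        \sum_(0 <= l < m.+1) (-1) ^+ l.+1 *: face m l.+1 f).
  rewrite -{1}[i.+1]add0n big_addn (comp_sumr _ hC) // scaler_sumr.
  rewrite (_ : i.+2 + m - i.+1 = m.+1)%N; last by lia.
  apply: eq_big_nat => l /andP[_ lt_lm]; rewrite (compZr _ hC) //.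
  by rewrite scalerA -exprD addnS addnC face_comp_mid // addnS.
(* The faces of h on the right of slot i. *)
have -> : \sum_(i.+2 + m <= k < (p + m).+3)
      (-1) ^+ k *: face (p + m) k (h \o_[m, i] f)
    = (-1) ^+ m *:
        ((\sum_(i.+2 <= k < p.+3) (-1) ^+ k *: face p k h) \o_[m, i] f).
  rewrite big_addn comp_suml scaler_sumr.
  rewrite (_ : (p + m).+3 - m = p.+3)%N; last by lia.
  apply: eq_big_nat => k /andP[lt_ik lt_kp]; rewrite compZl.
  by rewrite face_comp_gt ?lt_ik // exprD scalerA mulrC.
set S2 := \sum_(0 <= l < _) _; set S3 := \sum_(i.+2 <= k < _) _.
rewrite !compDl !compZl !(compDr _ hC) // (compZr _ hC) //.
rewrite (comp_face_first _ _ _ le_ip) (comp_face_last _ _ _ le_ip).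
abelian_signs.
Qed.

Lemma face_closed p k h : h \in C p -> face p k h \in C p.+1.
Proof.
move=> hC; case: k => [|k] /=; first exact: (comp_closed P muC hC).
case: ifP => [le_kp|_]; last exact: (comp_closed P muC hC).
by rewrite -[p.+1]addn1 (comp_closed P hC muC).
Qed.

Lemma cobd_closed p h : h \in C p -> cobd p h \in C p.+1.
Proof.
by move=> hC; apply: rpred_sum => k _; rewrite rpredZ // face_closed.
Qed.

Lemma cup_closed m n f g :
  f \in C m -> g \in C n -> cup m n f g \in C (m + n).+1.
Proof.
move=> fC gC; rewrite (_ : (m + n).+1 = 1 + n + m)%N; last by lia.
by apply: (comp_closed P) => //; apply: (comp_closed P).
Qed.

Lemma circ_closed m n f g :
  f \in C m -> g \in C n -> circ m n f g \in C (m + n)%N.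
Proof.
move=> fC gC; rewrite /circ big_nat rpred_sum // => i /andP[_ lt_im].
by rewrite rpredZ //; apply: (comp_closed P).
Qed.

Lemma bracket_closed m n f g :
  f \in C m -> g \in C n -> bracket m n f g \in C (m + n)%N.
Proof.
move=> fC gC; rewrite /bracket -scaleNr rpredD ?rpredZ ?circ_closed //.
by rewrite addnC circ_closed.
Qed.

Lemma brace_closed m n p f g h : f \in C m -> g \in C n -> h \in C p ->
  brace m n p f g h \in C (m + n + p)%N.
Proof.
move=> fC gC hC; rewrite /brace big_nat rpred_sum // => j /andP[_ lt_jm].
rewrite big_nat rpred_sum // => i /andP[_ lt_ij]; rewrite rpredZ //.
rewrite addnAC; do 2?[apply: (comp_closed P) => //]; lia.
Qed.

Lemma face_linear p k : linear (face p k).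
Proof.
case: k => [|k] c x y /=; first exact: (comp_linearr P _ muC).
by case: ifP => _; [exact: (comp_linearl P) | exact: (comp_linearr P _ muC)].
Qed.

Lemma cobd_linear p : linear (cobd p).
Proof.
move=> c x y; rewrite scaler_sumr -big_split; apply: eq_bigr => k _.
by rewrite face_linear scalerDr !scalerA mulrC.
Qed.

Lemma cobdZ p c f : cobd p (c *: f) = c *: cobd p f.
Proof. exact: (linearZZ (linear_pack (@cobd_linear p))). Qed.
Lemma cobdB p : {morph cobd p : x y / x - y}.
Proof. exact: (linearB (linear_pack (@cobd_linear p))). Qed.
Lemma cobdD p : {morph cobd p : x y / x + y}.
Proof. exact: (linearD (linear_pack (@cobd_linear p))). Qed.
Lemma cobd0 p : cobd p 0 = 0.
Proof. exact: (linear0 (linear_pack (@cobd_linear p))). Qed.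
Lemma cobd_sum p I r (Q : pred I) F :
  cobd p (\sum_(j <- r | Q j) F j) = \sum_(j <- r | Q j) cobd p (F j).
Proof. exact: (linear_sum (linear_pack (@cobd_linear p))). Qed.

Lemma cup_linearl m n g : g \in C n -> linear (fun f => cup m n f g).
Proof. by move=> gC; apply: (comp_linearr P _ (comp_closed P muC gC _)). Qed.
Lemma cup_linearr m n f : linear (cup m n f).
Proof.
by move=> c x y; rewrite /cup (comp_linearr P _ muC) // compDl compZl.
Qed.
Lemma circ_linearl m n g : linear (fun f => circ m n f g).
Proof.
move=> c x y; rewrite scaler_sumr -big_split; apply: eq_bigr => k _.
by rewrite compDl compZl scalerDr !scalerA mulrC.
Qed.
Lemma circ_linearr m n f : f \in C m -> linear (circ m n f).
Proof.
move=> fC c x y; rewrite scaler_sumr -big_split; apply: eq_big_nat => k lt_km.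
by rewrite (comp_linearr P _ fC) // scalerDr !scalerA mulrC.
Qed.

Lemma cup0l m n g : g \in C n -> cup m n 0 g = 0.
Proof. by move=> gC; apply: (linear0 (linear_pack (cup_linearl m gC))). Qed.
Lemma cup0r m n f : cup m n f 0 = 0.
Proof. exact: (linear0 (linear_pack (@cup_linearr m n f))). Qed.
Lemma circ0l m n g : circ m n 0 g = 0.
Proof. exact: (linear0 (linear_pack (@circ_linearl m n g))). Qed.
Lemma circ0r m n f : f \in C m -> circ m n f 0 = 0.
Proof. by move=> fC; apply: (linear0 (linear_pack (circ_linearr n fC))). Qed.

Lemma bracket_linearl m n g : g \in C n -> linear (fun f => bracket m n f g).
Proof.
move=> gC c x y; rewrite /bracket circ_linearl (circ_linearr _ gC).
by rewrite scalerBr !scalerDr !scalerA (mulrC c) opprD addrACA.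
Qed.

Lemma bracket_linearr m n f : f \in C m -> linear (bracket m n f).
Proof.
move=> fC c x y; rewrite /bracket circ_linearl (circ_linearr _ fC).
by rewrite scalerBr !scalerDr !scalerA (mulrC c) opprD addrACA.
Qed.

Lemma bracket0l m n g : g \in C n -> bracket m n 0 g = 0.
Proof. by move=> gC; apply: (linear0 (linear_pack (bracket_linearl m gC))). Qed.
Lemma bracket0r m n f : f \in C m -> bracket m n f 0 = 0.
Proof. by move=> fC; apply: (linear0 (linear_pack (bracket_linearr n fC))). Qed.

(** Both sides are the composites of f, g, h with one of the two products of
    mu with itself. *)
Lemma cup_assoc m n p f g h : h \in C p ->
  cup m (n + p).+1 f (cup n p g h) = cup (m + n).+1 p (cup m n f g) h.
Proof.
move=> hC; rewrite /cup.
rewrite (_ : (n + p).+1 = p.+1 + n)%N; last by lia.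
rewrite -(comp_seq P _ 1 _ _ _ (leq0n _)) -(comp_seq P _ 1 _ _ _ (leqnn 1)).
rewrite (_ : (m + n).+1 = n.+1 + m)%N; last by lia.
rewrite -(comp_seq P _ 0 _ _ _ (leq0n _)) -(comp_seq P _ 0 _ _ _ (leqnn 1)).
by rewrite -(comp_par P _ muC hC (ltn0Sn 0)) (mult_assoc P).
Qed.

Lemma cobd_mult : cobd 1 mu = 0.
Proof.
rewrite /cobd /face_sum !big_nat_recr //= big_geq // (mult_assoc P).
abelian_signs.
Qed.

(** Two applications of [cobd_comp], to mu o_1 g and then to its composite with
    f.  The partial sums of delta mu vanish or reduce to mu o_1 mu by
    associativity, so that no term but the two expected ones survives. *)
Lemma cobd_cup m n f g : f \in C m -> g \in C n ->
  cobd (m + n).+1 (cup m n f g)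
  = cup m.+1 n (cobd m f) g + (-1) ^+ m.+1 *: cup m n.+1 f (cobd n g).
Proof.
move=> fC gC.
have face1mu : face_sum 1 1 mu = 0.
  rewrite face_sumS /face_sum big_nat1 face_inner // (mult_assoc P).
  by rewrite expr0 expr1 scale1r scaleN1r subrr.
have face2mu : face_sum 1 2 mu = mu \o_[1, 1] mu.
  by rewrite face_sumS face1mu add0r face_inner // expr2 mulrNN mulr1 scale1r.
set X := mu \o_[n, 1] g.
have XC : X \in C n.+1 by apply: (comp_closed P muC gC).
have faceX0 : face_sum n.+1 0 X = (mu \o_[1, 1] mu) \o_[n, 2] g.
  rewrite /face_sum big_nat1 expr0 scale1r /= /X.
  by rewrite -(comp_seq P _ 1 _ _ _ (leqnn 1)).
have faceX1 : face_sum n.+1 1 X = 0.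
  rewrite face_sumS faceX0 face_inner // expr1 scaleN1r /X.
  by rewrite -(comp_par P _ muC gC (ltn0Sn 0)) (mult_assoc P) subrr.
have cobdX : cobd n.+1 X = face_sum n.+1 0 X - mu \o_[n.+1, 1] cobd n g.
  rewrite /X -[n.+1]/(1 + n)%N (cobd_comp muC gC) // face2mu face1mu cobd_mult.
  by rewrite subr0 comp0l scaler0 addr0 expr1 scaleN1r [(1 + n)%N]/= faceX0.
rewrite (_ : (m + n).+1 = n.+1 + m)%N; last by lia.
rewrite /cup -/X (cobd_comp XC fC) // faceX1 comp0l add0r expr0 scale1r.
rewrite cobdX addrAC subrr add0r -scaleN1r compZl scalerA addrC exprS mulrC.
by [].
Qed.

(** The composition product is a homotopy for graded commutativity.  The sum of
    [cobd_comp] over i telescopes; its end terms are the first face of h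
    composed with f in slot 0, which is f cup h, and the last face of h composed
    with f in slot p + 1, which is h cup f. *)
Lemma cobd_circ p m h f : h \in C p -> f \in C m ->
  cobd (p + m) (circ p m h f)
  = (-1) ^+ m *: circ p.+1 m (cobd p h) f + circ p m.+1 h (cobd m f)
    + (-1) ^+ (m * p + p.+1) *: cup p m h f - (-1) ^+ m *: cup m p f h.
Proof.
move=> hC fC; pose U i := (-1) ^+ (m * i.+1) *: (face_sum p i h \o_[m, i] f).
rewrite cobd_sum.
transitivity (\sum_(0 <= i < p.+1) ((U i.+1 - U i)
   + (-1) ^+ m *: ((-1) ^+ (m * i) *: (cobd p h \o_[m, i] f))
   + (-1) ^+ (m.+1 * i) *: (h \o_[m.+1, i] cobd m f))).
  apply: eq_big_nat => i lt_ip; rewrite cobdZ (cobd_comp hC fC) // compBl.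
  rewrite /U; set x := face_sum p i.+1 h; set y := face_sum p i h.
  abelian_signs.
rewrite 2!big_split /= telescope_sumr // -scaler_sumr.
have top : cobd p h = face_sum p p.+1 h + (-1) ^+ p *: (mu \o_[p, 0] h).
  by rewrite /cobd face_sumS face_last; abelian_signs.
have cup_hf : (mu \o_[p, 0] h) \o_[m, p.+1] f = cup p m h f.
  by rewrite -[p.+1]/(1 + p)%N (comp_par P _ hC fC (ltn0Sn 0)).
(* delta h has one more slot than h: the extra term of (delta h) o f completes
   the upper end term of the telescoping sum. *)
rewrite {1}/circ [in RHS]big_nat_recr //=.
rewrite -/(circ p m.+1 h (cobd m f)).
rewrite [X in X \o_[m, p.+1] f]top compDl compZl cup_hf.
rewrite {1 2}/U {2}/face_sum big_nat1 expr0 scale1r -/(cup m p f h).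
set Sg := bigop _ _ _; abelian_signs.
Qed.

(** In (f o_i g) o_k h the operation h is inserted into f on the left of g, into
    g, or into f on the right of g.  The middle case gives f o (g o h), and the
    other two give the braces f{h, g} and f{g, h}.  Hence the associator is
    graded symmetric in g and h, which is the right pre-Lie identity. *)
Lemma circ_associator m n p f g h : f \in C m -> g \in C n -> h \in C p ->
  circ (m + n) p (circ m n f g) h
  = circ m (n + p) f (circ n p g h)
    + (-1) ^+ (n * p) *: brace m n p f g h + brace m p n f h g.
Proof.
move=> fC gC hC.
transitivity (\sum_(0 <= i < m.+1)
    (\sum_(0 <= k < i) (-1) ^+ (p * k + n * i) *: ((f \o_[n, i] g) \o_[p, k] h)
     + (-1) ^+ ((n + p) * i) *: (f \o_[n + p, i] circ n p g h)
     + \sum_(i.+1 <= j < m.+1)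
         (-1) ^+ (n * p) *:
           ((-1) ^+ (n * i + p * j) *: ((f \o_[p, j] h) \o_[n, i] g)))).
  transitivity (\sum_(0 <= i < m.+1) \sum_(0 <= k < (m + n).+1)
      (-1) ^+ (p * k + n * i) *: ((f \o_[n, i] g) \o_[p, k] h)).
    rewrite exchange_big; apply: eq_bigr => k _.
    rewrite comp_suml scaler_sumr; apply: eq_bigr => i _.
    by rewrite compZl scalerA -exprD.
  apply: eq_big_nat => i /andP[_ lt_im].
  rewrite (@big_cat_nat _ _ _ i) //=; last by lia.
  rewrite (@big_cat_nat _ _ _ (i.+1 + n) i) //=; try lia.
  rewrite addrA; congr (_ + _ + _).
    rewrite -{1}[i]add0n big_addn (_ : i.+1 + n - i = n.+1)%N; last by lia.
    rewrite (comp_sumr _ fC) // scaler_sumr; apply: eq_big_nat => j lt_jn.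
    rewrite (compZr _ fC) // -(comp_seq P) 1?[(j + i)%N]addnC; last by lia.
    abelian_signs.
  rewrite big_addn (_ : (m + n).+1 - n = m.+1)%N; last by lia.
  apply: eq_big_nat => j /andP[lt_ij _].
  rewrite (comp_par P _ gC hC lt_ij); abelian_signs.
rewrite 2!big_split /= exchange_big_triangle.
rewrite [X in X + _ + _ = _](_ : _ = brace m p n f h g); last first.
  rewrite /brace; apply: eq_bigr => i _.
  by apply: eq_bigr => k _; rewrite addnC.
rewrite [X in _ + X = _](_ : _ = (-1) ^+ (n * p) *: brace m n p f g h).
  by rewrite [RHS]addrAC [X in X + _ = _]addrC.
by rewrite scaler_sumr; apply: eq_bigr => j _; rewrite scaler_sumr.
Qed.

(** On cochains, right composition with h is a graded derivation of the cup
    product, since h enters either f or g. *)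
Lemma circ_cup m n p f g h : f \in C m -> g \in C n -> h \in C p ->
  circ (m + n).+1 p (cup m n f g) h
  = cup (m + p) n (circ m p f h) g
    + (-1) ^+ (p * m.+1) *: cup m (n + p) f (circ n p g h).
Proof.
move=> fC gC hC; set X := mu \o_[n, 1] g.
have XC : X \in C n.+1 by apply: (comp_closed P muC gC).
rewrite /cup -/X /circ (@big_cat_nat _ _ _ m.+1) //=; last by lia.
congr (_ + _).
  rewrite (comp_sumr _ XC) //; apply: eq_big_nat => i lt_im.
  by rewrite (compZr _ XC) // -(comp_seq P _ 0) ?add0n.
rewrite -{1}[m.+1]add0n big_addn (_ : (m + n).+2 - m.+1 = n.+1)%N; last by lia.
rewrite (comp_sumr _ muC) // comp_suml scaler_sumr.
apply: eq_big_nat => i lt_in; rewrite (compZr _ muC) // compZl scalerA.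
rewrite (_ : i + m.+1 = i.+1 + m)%N; last by lia.
rewrite (comp_par P _ fC hC (ltn0Sn i)) -[i.+1]/(1 + i)%N (comp_seq P) //.
by congr (_ *: _); rewrite -exprD; congr (_ ^+ _); lia.
Qed.

(** The brace is a homotopy for the Leibniz rule in the other argument of the
    bracket: the composite of h with f cup g is the sum of the two derivation
    terms, up to a coboundary. *)
Lemma cobd_brace p m n h f g : h \in C p -> f \in C m -> g \in C n ->
  cobd p h = 0 -> cobd m f = 0 -> cobd n g = 0 ->
  cobd (p + m + n) (brace p m n h f g)
  = (-1) ^+ m *: (circ p (m + n).+1 h (cup m n f g)
      - cup m (p + n) f (circ p n h g)
      - (-1) ^+ (n.+1 * p) *: cup (p + m) n (circ p m h f) g).
Proof.
move=> hC fC gC dh df dg.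
pose A i j := face_sum p i h \o_[n, j] g \o_[m, i] f.
pose B i j := face_sum p j h \o_[n, j] g \o_[m, i] f.
pose a i j := (-1) ^+ (m * i.+1) *: A i j.
pose b i j := (-1) ^+ (n * j.+1) *: B i j.
(* Each term of the brace has as coboundary a difference in i plus a difference
   in j. *)
have step i j : (i < j <= p)%N ->
    (-1) ^+ (m * i + n * j) *: cobd (p + m + n) (h \o_[n, j] g \o_[m, i] f)
    = (-1) ^+ (n * j) *: (a i.+1 j.+1 - a i j.+1)
      + (-1) ^+ (m * i.+1) *: (b i j.+1 - b i j).
  move=> /andP[lt_ij le_jp]; have le_ip := ltnW (leq_trans lt_ij le_jp).
  rewrite addnAC (cobd_comp (comp_closed P hC gC le_jp) fC); last by lia.
  rewrite df (comp0r _ (comp_closed P hC gC le_jp)); last by lia.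
  rewrite (cobd_comp hC gC) // dg dh (comp0r _ hC) //.
  rewrite !face_sum_comp //; last by lia.
  rewrite !(compBl, compDl, compZl, comp0l).
  rewrite -/(A i.+1 j.+1) -/(B i j.+1) -/(A i j.+1) -/(B i j) /a /b.
  abelian_signs.
transitivity (\sum_(0 <= i < p.+1) ((-1) ^+ (n * i) *: (a i i.+1 - a 0%N i.+1)
    + (-1) ^+ (m * i.+1) *: (b i p.+1 - b i i.+1))).
  rewrite cobd_sum.
  transitivity (\sum_(0 <= j < p.+1) \sum_(0 <= i < j)
      ((-1) ^+ (n * j) *: (a i.+1 j.+1 - a i j.+1)
       + (-1) ^+ (m * i.+1) *: (b i j.+1 - b i j))).
    apply: eq_big_nat => j /andP[_ lt_jp]; rewrite cobd_sum.
    by apply: eq_big_nat => i /andP[_ lt_ij]; rewrite cobdZ step ?lt_ij.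
  under eq_bigr do rewrite big_split /=.
  rewrite big_split /= -[X in _ + X]exchange_big_triangle [RHS]big_split /=.
  congr (_ + _); apply: eq_big_nat => i /andP[_ lt_ip]; rewrite -scaler_sumr.
    by rewrite (@telescope_sumr _ 0 i (fun k => a k i.+1)).
  by rewrite (@telescope_sumr _ i.+1 p.+1 (b i)).
(* The upper end term: as h is a cocycle, all faces but the last sum up to minus
   the last one. *)
have b_last i : (i <= p)%N -> b i p.+1
    = (-1) ^+ (n * p + p.+1) *:
        ((mu \o_[n, 1] g) \o_[p + m, 0] (h \o_[m, i] f)).
  move=> le_ip; rewrite /b /B.
  have -> : face_sum p p.+1 h = (-1) ^+ p.+1 *: (mu \o_[p, 0] h).
    move: dh; rewrite /cobd face_sumS face_last => /eqP.
    by rewrite addr_eq0 => /eqP ->; abelian_signs.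
  rewrite !compZl -[p.+1 in X in X \o_[m, i] f]/(1 + p)%N.
  rewrite (comp_par P _ hC gC (ltn0Sn 0)).
  rewrite -(comp_seq P _ 0) // add0n; abelian_signs.
have a_first j : (j <= p)%N -> a 0%N j.+1
    = (-1) ^+ m *: (mu \o_[p + n, 1] (h \o_[n, j] g) \o_[m, 0] f).
  move=> le_jp; rewrite /a /A /face_sum big_nat1 expr0 scale1r muln1.
  by rewrite -[j.+1]/(1 + j)%N (comp_seq P).
(* On the diagonal the two telescoping sums differ by the single face of h that
   splits slot i, and f and g occupy its two halves. *)
have diag i : (i <= p)%N -> A i i.+1 - B i i.+1
    = (-1) ^+ i *: (h \o_[(m + n).+1, i] cup m n f g).
  move=> le_ip; rewrite /A /B face_sumS face_inner // !(compDl, compZl).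
  have -> : h \o_[(m + n).+1, i] cup m n f g
      = h \o_[1, i] mu \o_[n, i.+1] g \o_[m, i] f.
    rewrite (_ : (m + n).+1 = 1 + n + m)%N; last by lia.
    rewrite -(comp_seq P _ i _ _ _ (leq0n _)) addn0.
    by rewrite -(comp_seq P _ i _ _ _ (leqnn 1)) addn1.
  abelian_signs.
transitivity (\sum_(0 <= i < p.+1) (-1) ^+ m *:
   ((-1) ^+ ((m + n).+1 * i) *: (h \o_[(m + n).+1, i] cup m n f g)
    - (-1) ^+ (n * i) *: (mu \o_[p + n, 1] (h \o_[n, i] g) \o_[m, 0] f)
    - (-1) ^+ (n.+1 * p) *: ((-1) ^+ (m * i) *:
        ((mu \o_[n, 1] g) \o_[p + m, 0] (h \o_[m, i] f))))).
  apply: eq_big_nat => i /andP[_]; rewrite ltnS => le_ip.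
  rewrite b_last // a_first // /a /b.
  move/(congr1 (fun x => (-1) ^+ i *: x)): (diag i le_ip).
  rewrite scalerA -expr2 sqrr_sign scale1r => <-.
  abelian_signs.
rewrite -scaler_sumr; congr (_ *: _).
rewrite 2!big_split /= !sumrN -scaler_sumr; congr (_ - _ - _ *: _).
  rewrite /cup /circ (comp_sumr _ muC) // comp_suml.
  by apply: eq_bigr => i _; rewrite (compZr _ muC) // compZl.
rewrite /cup (comp_sumr _ (comp_closed P muC gC _)) //.
by apply: eq_bigr => i _; rewrite (compZr _ (comp_closed P muC gC _)).
Qed.

(** The cup products in [cobd_circ] for f o g and for g o f cancel. *)
Lemma cobd_bracket m n f g : f \in C m -> g \in C n ->
  cobd (m + n) (bracket m n f g)
  = (-1) ^+ n *: bracket m.+1 n (cobd m f) g + bracket m n.+1 f (cobd n g).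
Proof.
move=> fC gC; rewrite cobdB cobdZ {2}[(m + n)%N]addnC !cobd_circ // /bracket.
abelian_signs.
Qed.

Lemma bracketC m n f g : bracket m n f g = - (-1) ^+ (m * n) *: bracket n m g f.
Proof. by rewrite /bracket [(n * m)%N]mulnC scaleNr; abelian_signs. Qed.

(** Any graded pre-Lie product has a graded Lie commutator: expanding all
    associators by [circ_associator], the six iterated composites and the six
    braces cancel. *)
Lemma jacobi m n p f g h : f \in C m -> g \in C n -> h \in C p ->
  bracket m (n + p) f (bracket n p g h)
  = bracket (m + n) p (bracket m n f g) h
    + (-1) ^+ (m * n) *: bracket n (m + p) g (bracket m p f h).
Proof.
move=> fC gC hC; rewrite /bracket.
have circBZl a b (s : K) x y z :
    circ a b (x - s *: y) z = circ a b x z - s *: circ a b y z.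
  by rewrite addrC -scaleNr circ_linearl scaleNr addrC.
have circBZr a b (s : K) x y z : z \in C a ->
    circ a b z (x - s *: y) = circ a b z x - s *: circ a b z y.
  by move=> zC; rewrite addrC -scaleNr (circ_linearr _ zC) scaleNr addrC.
rewrite !circBZl !circBZr //.
have [fgh gfh] := (circ_associator fC gC hC, circ_associator gC fC hC).
have [ghf hgf] := (circ_associator gC hC fC, circ_associator hC gC fC).
have [fhg hfg] := (circ_associator fC hC gC, circ_associator hC fC gC).
move: fgh gfh ghf hgf fhg hfg.
rewrite ![(n + m)%N]addnC ![(p + n)%N]addnC ![(p + m)%N]addnC.
move=> -> -> -> -> -> ->.
abelian_signs.
Qed.

(** * Cocycles and coboundaries of the operad *)

Definition opcocycle n f := f \in C n /\ cobd n f = 0.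

(** Here f and g have degree n + 1, and n is the degree of the cochain between
    them. *)
Definition cohomologous n f g := exists2 h, h \in C n & f - g = cobd n h.

Lemma opcocycle_lin n c f g : opcocycle n f -> opcocycle n g ->
  opcocycle n (c *: f + g).
Proof.
move=> [fC df] [gC dg]; split; first by rewrite rpredD ?rpredZ.
by rewrite cobd_linear df dg scaler0 addr0.
Qed.

Lemma opcocycle_cup m n f g : opcocycle m f -> opcocycle n g ->
  opcocycle (m + n).+1 (cup m n f g).
Proof.
move=> [fC df] [gC dg]; split; first exact: cup_closed.
by rewrite cobd_cup // df dg cup0l // cup0r scaler0 addr0.
Qed.

Lemma opcocycle_bracket m n f g : opcocycle m f -> opcocycle n g ->
  opcocycle (m + n) (bracket m n f g).
Proof.
move=> [fC df] [gC dg]; split; first exact: bracket_closed.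
by rewrite cobd_bracket // df dg bracket0l // bracket0r // scaler0 addr0.
Qed.

Lemma cohomologous_refl n f : cohomologous n f f.
Proof. by exists 0; rewrite ?rpred0 // subrr cobd0. Qed.

(** The difference of the products is (f' - f) g' + f (g' - g), and each summand
    is a product of a coboundary and a cocycle; hence g' and f are the ones
    assumed to be cocycles. *)
Lemma cup_cohomologous m n f f' g g' :
  opcocycle m.+1 f -> opcocycle n.+1 g' ->
  cohomologous m f' f -> cohomologous n g' g ->
  cohomologous (m + n).+2 (cup m.+1 n.+1 f' g') (cup m.+1 n.+1 f g).
Proof.
move=> [fC df] [gC dg] [a aC fE] [b bC gE].
exists (cup m n.+1 a g' + (-1) ^+ m *: cup m.+1 n f b).
  rewrite rpredD ?rpredZ //; first by rewrite -addnS cup_closed.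
  by rewrite -addSn cup_closed.
have -> : cup m.+1 n.+1 f' g' - cup m.+1 n.+1 f g
    = cup m.+1 n.+1 (f' - f) g' + cup m.+1 n.+1 f (g' - g).
  rewrite ![_ - f]addrC ![_ - g]addrC -!scaleN1r cup_linearl //.
  rewrite cup_linearr !scaleN1r; abelian.
have da : cobd (m + n.+1).+1 (cup m n.+1 a g') = cup m.+1 n.+1 (cobd m a) g'.
  by rewrite cobd_cup // dg cup0r scaler0 addr0.
have db : cobd (m.+1 + n).+1 (cup m.+1 n f b)
    = (-1) ^+ m *: cup m.+1 n.+1 f (cobd n b).
  by rewrite cobd_cup // df cup0l // add0r; abelian_signs.
rewrite fE gE cobdD cobdZ.
by move: da db; rewrite addnS addSn => -> ->; abelian_signs.
Qed.

Lemma bracket_cohomologous m n f f' g g' :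
  opcocycle m.+1 f -> opcocycle n.+1 g' ->
  cohomologous m f' f -> cohomologous n g' g ->
  cohomologous (m + n).+1 (bracket m.+1 n.+1 f' g') (bracket m.+1 n.+1 f g).
Proof.
move=> [fC df] [gC dg] [a aC fE] [b bC gE].
exists ((-1) ^+ n.+1 *: bracket m n.+1 a g' + bracket m.+1 n f b).
  rewrite rpredD ?rpredZ //; first by rewrite -addnS bracket_closed.
  by rewrite -addSn bracket_closed.
have -> : bracket m.+1 n.+1 f' g' - bracket m.+1 n.+1 f g
    = bracket m.+1 n.+1 (f' - f) g' + bracket m.+1 n.+1 f (g' - g).
  rewrite ![_ - f]addrC ![_ - g]addrC -!scaleN1r bracket_linearl //.
  rewrite bracket_linearr // !scaleN1r; abelian.
have da : cobd (m + n.+1) (bracket m n.+1 a g')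
    = (-1) ^+ n.+1 *: bracket m.+1 n.+1 (cobd m a) g'.
  by rewrite cobd_bracket // dg bracket0r // addr0.
have db : cobd (m.+1 + n) (bracket m.+1 n f b) = bracket m.+1 n.+1 f (cobd n b).
  by rewrite cobd_bracket // df bracket0l // scaler0 add0r.
rewrite fE gE cobdD cobdZ.
by move: da db; rewrite addnS addSn => -> ->; abelian_signs.
Qed.

Lemma cup_commutes_up_to_cobd m n f g : opcocycle m f -> opcocycle n g ->
  cohomologous (m + n)
    (cup m n f g) ((-1) ^+ (m.+1 * n.+1) *: cup n m g f).
Proof.
move=> [fC df] [gC dg]; exists ((-1) ^+ (n * m + m.+1) *: circ m n f g).
  by rewrite rpredZ // circ_closed.
rewrite cobdZ cobd_circ // df dg circ0l circ0r //; abelian_signs.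
Qed.

Lemma leibniz_up_to_cobd m n p f g h :
  opcocycle m f -> opcocycle n g -> opcocycle p h ->
  cohomologous (m + n + p) (bracket (m + n).+1 p (cup m n f g) h)
    (cup (m + p) n (bracket m p f h) g
     + (-1) ^+ (p * m.+1) *: cup m (n + p) f (bracket n p g h)).
Proof.
move=> [fC df] [gC dg] [hC dh].
exists ((-1) ^+ ((m + n).+1 * p + m.+1) *: brace p m n h f g).
  by rewrite rpredZ // addnC addnA brace_closed.
rewrite (_ : m + n + p = p + m + n)%N; last by lia.
rewrite cobdZ cobd_brace // /bracket circ_cup //.
rewrite !(addrC (circ _ _ _ _)) -!scaleNr (cup_linearl _ gC) cup_linearr.
rewrite [(p + m)%N]addnC [(p + n)%N]addnC !scaleNr.
abelian_signs.
Qed.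

End Operad.

(** * The operad of a hom-associative algebra *)

Section HomOperad.
Variables (K : fieldType) (A : lmodType K).
Variables (mu : {bilinear A -> A -> A}) (alpha : {linear A -> A}).

Local Notation V := ((nat -> A) -> A).
Local Notation alphaX n := (iter n alpha).

Definition upd (a : nat -> A) (i : nat) x : nat -> A :=
  fun k => if k == i then x else a k.

(** Cochains of degree n are encoded as functions of an infinite sequence of
    arguments that depend on entries 0, ..., n only.  They all live in one
    vector space, and inserting operations is reindexing of sequences. *)
Definition hcochain_spec n (f : V) : Prop :=
  [/\ forall a b, (forall k, (k <= n)%N -> a k = b k) -> f a = f b,
      forall a i, (i <= n)%N -> linear (fun x => f (upd a i x))
    & forall a, alpha (f a) = f (alpha \o a)].

Definition hcochain n : {pred V} := fun f => `[< hcochain_spec n f >].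

Lemma hcochainP n f : reflect (hcochain_spec n f) (f \in hcochain n).
Proof. exact: asboolP. Qed.

Lemma hfct_linE c (f g : V) a : (c *: f + g) a = c *: f a + g a.
Proof. by []. Qed.

Fact hcochain_submod n : submod_closed (hcochain n).
Proof.
split=> [|c f g /hcochainP[fL fM fA] /hcochainP[gL gM gA]]; apply/hcochainP.
  split=> // [a i _ c x y|a]; last exact: linear0.
  by rewrite [RHS]addr0 [RHS]scaler0.
split=> [a b ab|a i le_in d x y|a]; rewrite ?hfct_linE.
- by rewrite (fL a b) // (gL a b).
- rewrite fM // gM //.
  by rewrite !scalerDr !scalerA (mulrC d c) addrACA.
- by rewrite linearP fA gA.
Qed.

HB.instance Definition _ n :=
  GRing.isSubmodClosed.Build K V (hcochain n) (hcochain_submod n).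

Definition hcomp_args n i (g : V) (a : nat -> A) : nat -> A := fun k =>
  if (k < i)%N then alphaX n (a k)
  else if k == i then g (fun l => a (i + l)%N)
  else alphaX n (a (k + n)%N).

Definition hcomp n i (f g : V) : V := fun a => f (hcomp_args n i g a).

Definition hmult : V := fun a => mu (a 0%N) (a 1%N).

Lemma iter_linear n : linear (alphaX n).
Proof. by elim: n => [|n IH] c x y //=; rewrite IH linearP. Qed.

Lemma iter_hcochain n p f a :
  f \in hcochain n -> alphaX p (f a) = f (alphaX p \o a).
Proof. by move=> /hcochainP[_ _ fA]; elim: p => //= p ->; rewrite fA. Qed.

(** For multilinearity: changing one argument of the composite changes exactly
    one argument of f, through alpha^n or through g. *)
Lemma hcomp_closed m n i f g :
  f \in hcochain m -> g \in hcochain n -> (i <= m)%N ->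
  hcomp n i f g \in hcochain (m + n).
Proof.
move=> fC gC le_im; have [fL fM fA] := hcochainP _ _ fC.
have [gL gM gA] := hcochainP _ _ gC; apply/hcochainP; split.
- move=> a b ab; apply: fL => k le_km; rewrite /hcomp_args.
  case: ltnP => [lt_ki|le_ik]; first by rewrite ab //; lia.
  case: eqP => [_|ne_ki]; last by rewrite ab //; lia.
  by apply: gL => l le_ln; apply: ab; lia.
- move=> a k le_k; set b := hcomp_args n i g a.
  suff [j [L [le_jm lL E]]] : exists j L, [/\ (j <= m)%N, linear L &
      forall x, hcomp_args n i g (upd a k x) = upd b j (L x)].
    by move=> c x y; rewrite /hcomp !E lL fM.
  have [lt_ki|le_ik] := ltnP k i.
    exists k, (alphaX n); split; [lia|exact: iter_linear|move=> x].
    apply/funext => l; rewrite /upd /b /hcomp_args.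
    case: (ltnP l i) => [lt_li|le_il]; first by case: eqP.
    have -> : (l == k) = false by lia.
    case: eqP => [_|ne_li]; last by rewrite ifF //; lia.
    by congr g; apply/funext => q; rewrite ifF //; lia.
  have [le_kin|lt_ink] := leqP k (i + n).
    exists i, (fun x => g (upd (fun l => a (i + l)%N) (k - i)%N x)).
    split=> // [|x]; first by apply: gM; lia.
    apply/funext => l; rewrite /upd /b /hcomp_args.
    case: (ltnP l i) => [lt_li|le_il].
      have -> : (l == i) = false by lia.
      by have -> : (l == k) = false by lia.
    case: eqP => [_|ne_li]; last by rewrite ifF //; lia.
    congr g; apply/funext => q.
    by rewrite (_ : (i + q == k)%N = (q == k - i)%N) //; lia.
  exists (k - n)%N, (alphaX n); split; [lia|exact: iter_linear|move=> x].
  apply/funext => l; rewrite /upd /b /hcomp_args.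
  case: (ltnP l i) => [lt_li|le_il]; first by rewrite !ifF //; lia.
  case: eqP => [->|ne_li].
    have -> : (i == k - n)%N = false by lia.
    by apply: gL => q le_qn; rewrite ifF //; lia.
  have -> : (l + n == k)%N = (l == k - n)%N by lia.
  by case: eqP.
- move=> a; rewrite fA; congr f; apply/funext => k; rewrite /hcomp_args /=.
  by rewrite !(fun_if alpha) gA -!iterS !iterSr.
Qed.

Lemma hcomp_linearr m n i f : f \in hcochain m -> (i <= m)%N ->
  linear (hcomp n i f).
Proof.
move=> /hcochainP[fL fM fA] le_im c g h; apply/funext => a.
rewrite /hcomp [RHS]/(c *: f _ + f _).
have E x : hcomp_args n i x a
    = upd (hcomp_args n i 0 a) i (x (fun l => a (i + l)%N)).
  apply/funext => k; rewrite /upd /hcomp_args.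
  by case: eqP => [->|//]; rewrite ltnn.
by rewrite (E g) (E h) (E (c *: g + h)); apply: fM.
Qed.

Lemma hcomp_seq n p i j f g h : (j <= n)%N ->
  hcomp p (i + j) (hcomp n i f g) h = hcomp (n + p) i f (hcomp p j g h).
Proof.
move=> le_jn; apply/funext => a; rewrite /hcomp; congr f; apply/funext => k.
rewrite /hcomp_args; case: (ltnP k i) => [lt_ki|le_ik].
  by rewrite ifT ?iterD //; lia.
case: eqP => [_|ne_ki].
  congr g; apply/funext => l; rewrite ltn_add2l eqn_add2l.
  do 2?case: ifP => // _; congr h || rewrite addnA //.
  by apply/funext => q; rewrite addnA.
by rewrite !ifF ?addnA ?iterD //; lia.
Qed.

(** The operation inserted first is twisted by the degree of the other one; it
    commutes with alpha, so that the twist moves to its arguments. *)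
Lemma hcomp_par n p i k f g h :
  g \in hcochain n -> h \in hcochain p -> (i < k)%N ->
  hcomp p (k + n) (hcomp n i f g) h = hcomp n i (hcomp p k f h) g.
Proof.
move=> gC hC lt_ik; have [gL _ _] := hcochainP _ _ gC.
apply/funext => a; rewrite /hcomp; congr f; apply/funext => q.
rewrite /hcomp_args; case: (ltnP q i) => [lt_qi|le_iq].
  by rewrite !ifT ?lt_qi -?iterD 1?addnC //; lia.
case: (eqVneq q i) => [->|ne_qi].
  rewrite lt_ik (iter_hcochain _ _ gC); apply: gL => l le_ln /=.
  by rewrite ifT //; lia.
rewrite ltn_add2r eqn_add2r.
case: (ltnP q k) => [lt_qk|le_kq].
  by rewrite ?ifF -?iterD 1?addnC //; lia.
case: (eqVneq q k) => [_|ne_qk].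
  rewrite (iter_hcochain _ _ hC); congr h; apply/funext => l /=.
  by rewrite !ifF; [congr (iter _ _ (a _)); lia | lia | lia].
by rewrite !ifF -?iterD 1?addnC -?addnA 1?[(n + p)%N]addnC //; lia.
Qed.

Hypothesis homA : hom_associative mu alpha.

(** Multiplicativity of alpha makes mu a cochain; hom-associativity is the
    associativity of mu in the operad. *)
Lemma hom_operad :
  operad_with_multiplication hcochain hcomp hmult.
Proof.
have [muA muM] := homA; split.
- exact: hcomp_closed.
- by move=> n i g c x y; apply/funext.
- exact: hcomp_linearr.
- exact: hcomp_seq.
- exact: hcomp_par.
- apply/hcochainP; split=> [a b ab|a [|[|i]] // _ c x y|a].
  + by rewrite /hmult !ab.
  + exact: linearPl.
  + exact: linearPr.
  + exact: muM.
- by apply/funext => a; apply/esym/muA.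
Qed.

End HomOperad.

(** * From cochains on sequences to cochains on tuples *)

Section Cohomology.
Variables (K : fieldType) (A : lmodType K).
Variables (mu : {bilinear A -> A -> A}) (alpha : {linear A -> A}).
Hypothesis homA : hom_associative mu alpha.

Local Notation V := ((nat -> A) -> A).
Local Notation hC := (@hcochain K A alpha).
Local Notation hcirc := (@circ K V (@hcomp K A alpha)).
Local Notation hbracket := (@bracket K V (@hcomp K A alpha)).
Local Notation hcup := (@cup K V (@hcomp K A alpha) (@hmult K A mu)).
Local Notation hcobd := (@cobd K V (@hcomp K A alpha) (@hmult K A mu)).
Local Notation hcocycle :=
  (@opcocycle K V hC (@hcomp K A alpha) (@hmult K A mu)).
Local Notation hcohomologous :=
  (@cohomologous K V hC (@hcomp K A alpha) (@hmult K A mu)).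
Local Notation P := (hom_operad homA).

(** For n = m + 1 this is an isomorphism from the cochains of degree m onto the
    cochains of arity n, and it carries the operations of the operad to the
    twisted coboundary, cup product and bracket.  The default value 0 beyond the
    last entry is harmless, as cochains do not read these entries. *)
Definition on_tuples n (F : V) : n.-tuple A -> A := fun a => F (nth 0 a).

Lemma on_tuples_mktuple n F b : F \in hC n ->
  on_tuples F [tuple b (nat_of_ord k) | k < n.+1] = F b.
Proof.
move=> /hcochainP[FL _ _]; apply: FL => k le_kn.
have lt_kn : (k < n.+1)%N by [].
by rewrite -[k]/(nat_of_ord (Ordinal lt_kn)) -tnth_nth tnth_mktuple.
Qed.

Lemma on_tuples_inj n F G : F \in hC n -> G \in hC n ->
  on_tuples (n := n.+1) F = on_tuples G -> F = G.
Proof.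
move=> FC GC FG; apply/funext => a.
by rewrite -(on_tuples_mktuple _ FC) FG on_tuples_mktuple.
Qed.

Lemma on_tuples_cochain n F : F \in hC n -> on_tuples F \in cochain alpha n.+1.
Proof.
move=> FC; have [FL FM FA] := hcochainP _ _ _ FC; apply/cochainP; split.
  move=> a i c x y /=.
  rewrite !(on_tuples_mktuple (fun k => if k == i then _ else a`_k)) //.
  exact: (FM (nth 0 a) i (ltn_ord i)).
by move=> a; rewrite (on_tuples_mktuple (fun k => alpha a`_k)) // -FA.
Qed.

Lemma cochain_on_tuples n f : f \in cochain alpha n.+1 ->
  exists2 F, F \in hC n & f = on_tuples F.
Proof.
move=> /cochainP[fM fA].
exists (fun a => f [tuple a (nat_of_ord k) | k < n.+1]).
  apply/hcochainP; split.
  - by move=> a b ab; congr f; apply: eq_mktuple => k; apply: ab; rewrite -ltnS.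
  - move=> a i le_in c x y; have lt_in : (i < n.+1)%N by [].
    have := fM [tuple a (nat_of_ord k) | k < n.+1] (Ordinal lt_in) c x y.
    have E z : [tuple if k == Ordinal lt_in then z
                  else [tuple a (nat_of_ord k) | k < n.+1]`_k | k < n.+1]
        = [tuple upd a i z (nat_of_ord k) | k < n.+1].
      apply: eq_mktuple => k; rewrite /upd -val_eqE /=; case: eqP => // _.
      by rewrite nth_mktuple.
    by rewrite !E.
  - move=> a; rewrite fA; congr f; apply: eq_mktuple => k.
    by rewrite nth_mktuple.
apply/funext => a; rewrite /on_tuples; congr f; apply: eq_from_tnth => k.
by rewrite tnth_mktuple (tnth_nth 0).
Qed.

Lemma on_tuples_cobd n F : F \in hC n ->
  coboundary mu alpha (on_tuples (n := n.+1) F) = on_tuples (hcobd n F).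
Proof.
move=> FC; apply/funext => a; rewrite /coboundary [in RHS]/on_tuples.
rewrite (cobdE (hcomp alpha)) fct_sumE.
set b := nth 0 a; set compF := hcomp alpha.
rewrite -[RHS]/(compF n 1%N (hmult mu) F b
  + \sum_(i < n.+1) (-1) ^+ i.+1 *: compF 1%N i F (hmult mu) b
  + (-1) ^+ n.+2 *: compF n 0%N (hmult mu) F b).
congr (_ + _ + _ *: _).
- by rewrite (on_tuples_mktuple (fun k => b k.+1)).
- apply: eq_bigr => i _; congr (_ *: _).
  rewrite (on_tuples_mktuple (fun k => if (k < i)%N then alpha (b k) else
    if k == i then mu (b k) (b k.+1) else alpha (b k.+1))) //.
  rewrite /compF /hcomp; congr F; apply/funext => k; rewrite /hcomp_args /hmult.
  by case: ltnP => // _; case: eqP => [->|_]; rewrite ?addn0 !addn1.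
- by rewrite (on_tuples_mktuple b).
Qed.

Lemma on_tuples_cup m n F G : F \in hC m -> G \in hC n ->
  cup_cochain mu alpha (on_tuples (n := m.+1) F) (on_tuples (n := n.+1) G)
  = on_tuples (hcup m n F G).
Proof.
move=> FC GC; apply/funext => a; rewrite /cup_cochain.
rewrite (on_tuples_mktuple (fun k => iter n alpha a`_k)) //.
rewrite (on_tuples_mktuple (fun k => iter m alpha a`_(m.+1 + k))) //.
rewrite /on_tuples /cup /hcomp /hmult /hcomp_args /=; congr (mu _ _).
  by rewrite (iter_hcochain _ _ FC).
congr G; apply/funext => k; congr (iter _ _ _`_ _).
by rewrite addSnnS addnC.
Qed.

Lemma on_tuples_circ m n F G : F \in hC m -> G \in hC n ->
  circ_cochain alpha (on_tuples (n := m.+1) F) (on_tuples (n := n.+1) G)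
  = on_tuples (hcirc m n F G).
Proof.
move=> FC GC; apply/funext => a; rewrite /circ_cochain {2}/on_tuples /circ.
rewrite big_mkord fct_sumE; apply: eq_bigr => i _.
rewrite [RHS]/(_ *: hcomp _ _ _ _ _ _); congr (_ *: _).
set b := nth 0 a.
rewrite (on_tuples_mktuple (fun k => if (k < i)%N then iter n alpha (b k) else
    if k == i then on_tuples G [tuple b (i + l)%N | l < n.+1]
    else iter n alpha (b (k + n)%N))) //.
rewrite /hcomp; congr F; apply/funext => k; rewrite /hcomp_args.
by rewrite (on_tuples_mktuple (fun l => b (i + l)%N)).
Qed.

Lemma on_tuples_bracket m n F G : F \in hC m -> G \in hC n ->
  bracket_cochain alpha (on_tuples (n := m.+1) F) (on_tuples (n := n.+1) G)
  = on_tuples (hbracket m n F G).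
Proof.
move=> FC GC; apply/funext => a; rewrite /bracket_cochain !on_tuples_circ //.
by rewrite /on_tuples val_tcast.
Qed.

Lemma on_tuples_cocycle n F :
  hcocycle n F -> on_tuples F \in cocycle mu alpha n.+1.
Proof.
move=> [FC dF]; apply/cocycleP; split; first exact: on_tuples_cochain.
by move=> a; rewrite on_tuples_cobd // dF.
Qed.

Lemma on_tuples_cocycle_cast N n F : N = n.+1 -> hcocycle n F ->
  on_tuples (n := N) F \in cocycle mu alpha N.
Proof. by move=> ->; apply: on_tuples_cocycle. Qed.

Lemma cocycle_on_tuples n f : f \in cocycle mu alpha n.+1 ->
  exists2 F, hcocycle n F & f = on_tuples F.
Proof.
move=> /cocycleP[/cochain_on_tuples[F FC ->] dF]; exists F => //; split=> //.
apply: (@on_tuples_inj n.+1).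
- exact: (cobd_closed P).
- exact: rpred0.
- by rewrite -on_tuples_cobd //; apply/funext => a; rewrite dF.
Qed.

(** * Operations on cohomology *)

Local Notation H := (cohomology mu alpha).

Definition cls (i : int) (F : V) : H i :=
  match i with
  | Posz n => cohomology_class mu alpha (on_tuples F)
  | Negz _ => 0
  end.

Lemma cls_eq n F G : hcocycle n.+1 F -> hcocycle n.+1 G ->
  cls n.+2 F = cls n.+2 G <-> hcohomologous n F G.
Proof.
move=> FZ GZ; rewrite cohomology_class_eq ?on_tuples_cocycle //.
split=> [[h /cochain_on_tuples[h' hC' ->]]|[h hC' FG]].
  rewrite on_tuples_cobd // => FG; exists h' => //.
  apply: (@on_tuples_inj n.+1) => //; last exact: (cobd_closed P).
  by rewrite -scaleN1r addrC rpredD ?rpredZ; case: FZ GZ => ? ? [].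
exists (on_tuples h); first exact: on_tuples_cochain.
by rewrite on_tuples_cobd // -FG.
Qed.

Lemma cls_surj n (x : H n.+2) : exists2 F, hcocycle n.+1 F & cls n.+2 F = x.
Proof.
have [f /cocycle_on_tuples[F FZ ->] <-] := cohomology_class_surj x.
by exists F.
Qed.

Lemma cls_lin n c F G : hcocycle n.+1 F -> hcocycle n.+1 G ->
  cls n.+2 (c *: F + G) = c *: cls n.+2 F + cls n.+2 G.
Proof.
move=> FZ GZ; rewrite /cls /cohomology_class -linearP; congr module_proj.
apply: val_inj.
by rewrite /= !val_insubd !on_tuples_cocycle //; apply: (opcocycle_lin P).
Qed.

(** The equation between the integer i and the natural m + 1 is part of the
    relation, so that degrees such as i + j - 1 need not be brought into another
    form, and transport along equalities of degrees leaves the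
    representative unchanged ([represents_cast]).  Only degrees i >= 2 have
    representatives; in the other degrees the cohomology is 0. *)
Definition represents i m F (x : H i) : Prop :=
  [/\ i = m.+1%:Z, (0 < m)%N, hcocycle m F & x = cls i F].

Lemma represents_cohomologous i m n F G (x y : H i) :
  represents m F x -> represents n G y -> hcohomologous m.-1 F G -> x = y.
Proof.
move=> [iE m_gt0 FZ ->]; subst i => -[[mn] _ GZ ->] FG; subst n.
by destruct m as [|m] => //; apply/(cls_eq FZ GZ).
Qed.

Lemma represents_unique i m n F (x y : H i) :
  represents m F x -> represents n F y -> x = y.
Proof.
move=> Fx Fy.
exact: (represents_cohomologous Fx Fy (cohomologous_refl P _ _)).
Qed.

Lemma represents_cls i m F :
  i = m.+1%:Z -> (0 < m)%N -> hcocycle m F -> represents m F (cls i F).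
Proof. by []. Qed.

Lemma represents_lin i m n c F G (x y : H i) :
  represents m F x -> represents n G y ->
  represents m (c *: F + G) (c *: x + y).
Proof.
move=> [iE m_gt0 FZ ->]; subst i => -[[mn] _ GZ ->]; subst n.
split=> //; first exact: (opcocycle_lin P).
by destruct m as [|m] => //; rewrite cls_lin.
Qed.

Lemma represents_add i m n F G (x y : H i) :
  represents m F x -> represents n G y -> represents m (F + G) (x + y).
Proof. by move=> Fx Gy; have := represents_lin 1 Fx Gy; rewrite !scale1r. Qed.

Lemma represents_scale i m c F (x : H i) :
  represents m F x -> represents m (c *: F) (c *: x).
Proof.
move=> Fx; have := represents_lin (c - 1) Fx Fx.
by rewrite !scalerBl !scale1r !subrK.
Qed.

Lemma represents_cast i j (e : i = j) m F (x : H i) :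
  represents m F x -> represents m F (ecast d (H d) e x).
Proof. by case: j / e. Qed.

(** Positive exactly when i >= 2. *)
Definition shifted_degree (i : int) : nat := if i is Posz m.+1 then m else 0%N.

Lemma represents_exists i (x : H i) :
  exists F, (0 < shifted_degree i)%N -> represents (shifted_degree i) F x.
Proof.
case: i x => [[|[|n]]|n] x /=; try by exists 0.
by have [F FZ <-] := cls_surj x; exists F.
Qed.

(** A choice of cocycle in every class; by [represents_cup] and
    [represents_bracket] the operations do not depend on it. *)
Definition representative i (x : H i) : V := sval (cid (represents_exists x)).

Lemma representativeP i (x : H i) : (0 < shifted_degree i)%N ->
  represents (shifted_degree i) (representative x) x.
Proof. exact: svalP (cid (represents_exists x)). Qed.

Lemma class_cases i (x : H i) :
  x = 0 \/ exists m F, represents m F x.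
Proof.
case: (posnP (shifted_degree i)) => [i0|i_gt0]; last first.
  right; exists (shifted_degree i), (representative x).
  exact: representativeP.
by left; case: i x i0 => [[|[|n]]|n] x //= _; apply/rowP => -[].
Qed.

Definition cohomology_cup i j (x : H i) (y : H j) : H (i + j) :=
  let m := shifted_degree i in let n := shifted_degree j in
  if (0 < m)%N && (0 < n)%N
  then cls (i + j) (hcup m n (representative x) (representative y)) else 0.

Definition cohomology_bracket i j (x : H i) (y : H j) : H (i + j - 1) :=
  let m := shifted_degree i in let n := shifted_degree j in
  if (0 < m)%N && (0 < n)%N
  then cls (i + j - 1) (hbracket m n (representative x) (representative y))
  else 0.

Lemma represents_degree i m F (x : H i) :
  represents m F x -> shifted_degree i = m.
Proof. by case=> iE *; rewrite iE. Qed.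

Lemma represents_diff i m F G (x : H i) :
  represents m F x -> represents m G x ->
  hcohomologous m.-1 F G.
Proof.
move=> [iE m_gt0 FZ ->]; subst i => -[_ _ GZ]; destruct m as [|m] => //.
by move/(cls_eq FZ GZ).
Qed.

Lemma represents_cup i j m n F G (x : H i) (y : H j) :
  represents m F x -> represents n G y ->
  represents (m + n).+1 (hcup m n F G) (cohomology_cup x y).
Proof.
move=> Fx Gy; have [iE m_gt0 FZ _] := Fx; have [jE n_gt0 GZ _] := Gy.
have ijE : i + j = (m + n).+2%:Z by rewrite iE jE -PoszD addSn addnS.
have := (@representativeP i x, @representativeP j y).
rewrite /cohomology_cup (represents_degree Fx) (represents_degree Gy).
rewrite m_gt0 n_gt0 => -[/(_ isT) Fx' /(_ isT) Gy'].
have [[_ _ FZ' _] [_ _ GZ' _]] := (Fx', Gy').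
split=> //; first exact: (opcocycle_cup P).
apply: (@represents_cohomologous _ (m + n).+1 (m + n).+1) => //.
- by split=> //; apply: (opcocycle_cup P).
- by split=> //; apply: (opcocycle_cup P).
have FF := represents_diff Fx' Fx; have GG := represents_diff Gy' Gy.
destruct m as [|m], n as [|n] => //.
by rewrite addSn addnS; apply: (cup_cohomologous P).
Qed.

Lemma represents_bracket i j m n F G (x : H i) (y : H j) :
  represents m F x -> represents n G y ->
  represents (m + n) (hbracket m n F G) (cohomology_bracket x y).
Proof.
move=> Fx Gy; have [iE m_gt0 FZ _] := Fx; have [jE n_gt0 GZ _] := Gy.
have ijE : i + j - 1 = (m + n).+1%:Z by rewrite iE jE; lia.
have mn_gt0 : (0 < m + n)%N by rewrite addn_gt0 m_gt0.
have := (@representativeP i x, @representativeP j y).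
rewrite /cohomology_bracket (represents_degree Fx) (represents_degree Gy).
rewrite m_gt0 n_gt0 => -[/(_ isT) Fx' /(_ isT) Gy'].
have [[_ _ FZ' _] [_ _ GZ' _]] := (Fx', Gy').
split=> //; first exact: (opcocycle_bracket P).
apply: (@represents_cohomologous _ (m + n) (m + n)) => //.
- by split=> //; apply: (opcocycle_bracket P).
- by split=> //; apply: (opcocycle_bracket P).
have FF := represents_diff Fx' Fx; have GG := represents_diff Gy' Gy.
destruct m as [|m], n as [|n] => //.
by rewrite addSn addnS; apply: (bracket_cohomologous P).
Qed.

Lemma cup_low i j (x : H i) (y : H j) :
  ~~ ((0 < shifted_degree i)%N && (0 < shifted_degree j)%N) ->
  cohomology_cup x y = 0.
Proof. by rewrite /cohomology_cup => /negPf ->. Qed.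

Lemma bracket_low i j (x : H i) (y : H j) :
  ~~ ((0 < shifted_degree i)%N && (0 < shifted_degree j)%N) ->
  cohomology_bracket x y = 0.
Proof. by rewrite /cohomology_bracket => /negPf ->. Qed.

Lemma cohomology_cup_bilinear i j :
  bilinear_for *:%R *:%R (@cohomology_cup i j).
Proof.
have [|ij] := boolP ((0 < shifted_degree i)%N && (0 < shifted_degree j)%N);
  last first.
  by split=> [y c x x'|x c y y']; rewrite /= !cup_low // scaler0 addr0.
move=> /andP[i_gt0 j_gt0]; split=> [y c x x'|x c y y'].
  have [Fx Fx'] := (representativeP x i_gt0, representativeP x' i_gt0).
  have Gy := representativeP y j_gt0; have [_ _ [GC _] _] := Gy.
  have := represents_cup (represents_lin c Fx Fx') Gy.
  rewrite (cup_linearl P _ GC) => /represents_unique; apply.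
  exact: represents_lin (represents_cup Fx Gy) (represents_cup Fx' Gy).
have [Gy Gy'] := (representativeP y j_gt0, representativeP y' j_gt0).
have Fx := representativeP x i_gt0.
have := represents_cup Fx (represents_lin c Gy Gy').
rewrite (cup_linearr P) => /represents_unique; apply.
exact: represents_lin (represents_cup Fx Gy) (represents_cup Fx Gy').
Qed.

Lemma cohomology_bracket_bilinear i j :
  bilinear_for *:%R *:%R (@cohomology_bracket i j).
Proof.
have [|ij] := boolP ((0 < shifted_degree i)%N && (0 < shifted_degree j)%N);
  last first.
  by split=> [y c x x'|x c y y']; rewrite /= !bracket_low // scaler0 addr0.
move=> /andP[i_gt0 j_gt0]; split=> [y c x x'|x c y y'].
  have [Fx Fx'] := (representativeP x i_gt0, representativeP x' i_gt0).
  have Gy := representativeP y j_gt0; have [_ _ [GC _] _] := Gy.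
  have := represents_bracket (represents_lin c Fx Fx') Gy.
  rewrite (bracket_linearl P _ GC) => /represents_unique; apply.
  exact: represents_lin (represents_bracket Fx Gy) (represents_bracket Fx' Gy).
have [Gy Gy'] := (representativeP y j_gt0, representativeP y' j_gt0).
have Fx := representativeP x i_gt0; have [_ _ [FC _] _] := Fx.
have := represents_bracket Fx (represents_lin c Gy Gy').
rewrite (bracket_linearr P _ FC) => /represents_unique; apply.
exact: represents_lin (represents_bracket Fx Gy) (represents_bracket Fx Gy').
Qed.

Lemma cup0x i j (y : H j) : cohomology_cup (0 : H i) y = 0.
Proof. exact: (linear0 (linear_pack ((cohomology_cup_bilinear i j).1 y))). Qed.

Lemma cupx0 i j (x : H i) : cohomology_cup x (0 : H j) = 0.
Proof. exact: (linear0 (linear_pack ((cohomology_cup_bilinear i j).2 x))). Qed.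

Lemma bracket0x i j (y : H j) : cohomology_bracket (0 : H i) y = 0.
Proof.
exact: (linear0 (linear_pack ((cohomology_bracket_bilinear i j).1 y))).
Qed.

Lemma bracketx0 i j (x : H i) : cohomology_bracket x (0 : H j) = 0.
Proof.
exact: (linear0 (linear_pack ((cohomology_bracket_bilinear i j).2 x))).
Qed.

Lemma ecast0 i j (e : i = j) : ecast d (H d) e 0 = 0.
Proof. by case: j / e. Qed.

Lemma sign_degreesM (i j : int) m n : i = m%:Z -> j = n%:Z ->
  (-1) ^ (i * j) = (-1) ^+ (m * n) :> K.
Proof. by move=> -> ->; rewrite -PoszM. Qed.

Lemma degree_pred (i : int) m : i = m.+1%:Z -> i - 1 = m%:Z.
Proof. by move=> ->; rewrite intS addrC addKr. Qed.

Let zero_simp :=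
  (cup0x, cupx0, bracket0x, bracketx0, ecast0, scaler0, addr0, oppr0).

(** When an argument is 0, both sides vanish by bilinearity.  Otherwise all
    arguments have representatives, and each axiom is the identity between
    cochains, or its version up to a coboundary, proved for the operad. *)
Lemma cohomology_gerstenhaber :
  is_gerstenhaber cohomology_cup cohomology_bracket.
Proof.
split.
- exact: cohomology_cup_bilinear.
- move=> i j k a b c.
  case: (class_cases a) => [->|[m [F Fa]]]; first by rewrite !zero_simp.
  case: (class_cases b) => [->|[n [G Gb]]]; first by rewrite !zero_simp.
  case: (class_cases c) => [->|[p [X Xc]]]; first by rewrite !zero_simp.
  have [_ _ [XC _] _] := Xc.
  have := represents_cast (addrA i j k)
    (represents_cup Fa (represents_cup Gb Xc)).
  rewrite (cup_assoc P _ _ _ _ XC) => /represents_unique; apply.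
  by do 2?apply: represents_cup.
- move=> i j a b.
  case: (class_cases a) => [->|[m [F Fa]]]; first by rewrite !zero_simp.
  case: (class_cases b) => [->|[n [G Gb]]]; first by rewrite !zero_simp.
  have [[iE _ FZ _] [jE _ GZ _]] := (Fa, Gb).
  apply: (represents_cohomologous (represents_cup Fa Gb)
    (represents_scale _ (represents_cast _ (represents_cup Gb Fa)))).
  by rewrite (sign_degreesM iE jE); apply: (cup_commutes_up_to_cobd P).
- exact: cohomology_bracket_bilinear.
- move=> i j a b.
  case: (class_cases a) => [->|[m [F Fa]]]; first by rewrite !zero_simp.
  case: (class_cases b) => [->|[n [G Gb]]]; first by rewrite !zero_simp.
  have [[iE _ _ _] [jE _ _ _]] := (Fa, Gb).
  rewrite -scaleNr (sign_degreesM (degree_pred iE) (degree_pred jE)).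
  apply: (represents_unique (represents_bracket Fa Gb)); rewrite bracketC.
  exact: (represents_scale _ (represents_cast _ (represents_bracket Gb Fa))).
- move=> i j k a b c.
  case: (class_cases a) => [->|[m [F Fa]]]; first by rewrite !zero_simp.
  case: (class_cases b) => [->|[n [G Gb]]]; first by rewrite !zero_simp.
  case: (class_cases c) => [->|[p [X Xc]]]; first by rewrite !zero_simp.
  have [[[iE _ [FC _] _] [jE _ [GC _] _]] [kE _ [XC _] _]] := (Fa, Gb, Xc).
  rewrite (sign_degreesM (degree_pred iE) (degree_pred jE)).
  apply: (represents_unique (represents_bracket Fa (represents_bracket Gb Xc))).
  rewrite (jacobi P FC GC XC); apply: represents_add.
    by apply: represents_cast; do 2?apply: represents_bracket.
  apply: represents_scale; apply: represents_cast.
  by do 2?apply: represents_bracket.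
- move=> i j k a b c.
  case: (class_cases a) => [->|[m [F Fa]]]; first by rewrite !zero_simp.
  case: (class_cases b) => [->|[n [G Gb]]]; first by rewrite !zero_simp.
  case: (class_cases c) => [->|[p [X Xc]]]; first by rewrite !zero_simp.
  have [[[iE _ FZ _] [jE _ GZ _]] [kE _ XZ _]] := (Fa, Gb, Xc).
  rewrite (sign_degreesM (degree_pred kE) iE).
  have abc := represents_bracket (represents_cup Fa Gb) Xc.
  apply: (represents_cohomologous abc _ (leibniz_up_to_cobd P FZ GZ XZ)).
  apply: represents_add.
    apply: represents_cast; apply: represents_cup => //.
    exact: represents_bracket.
  apply: represents_scale; apply: represents_cast; apply: represents_cup => //.
  exact: represents_bracket.
Qed.

End Cohomology.

Theorem theorem6p6 (K : fieldType) (charK : [pchar K] =i pred0)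
    (A : lmodType K) (mu : {bilinear A -> A -> A}) (alpha : {linear A -> A})
    (homA : hom_associative mu alpha) :
  let H := cohomology mu alpha in
  exists (cup : forall i j : int, H i -> H j -> H (i + j))
         (br : forall i j : int, H i -> H j -> H (i + j - 1)),
    [/\ forall (m n : nat) (f : m.-tuple A -> A) (g : n.-tuple A -> A),
          (2 <= m)%N -> (2 <= n)%N ->
          f \in cocycle mu alpha m -> g \in cocycle mu alpha n ->
          cup_cochain mu alpha f g \in cocycle mu alpha (m + n)
          /\ cup m n (cohomology_class mu alpha f) (cohomology_class mu alpha g)
             = cohomology_class mu alpha (cup_cochain mu alpha f g),
        forall (m n : nat) (f : m.-tuple A -> A) (g : n.-tuple A -> A)
          (m_ge2 : (2 <= m)%N),
          (2 <= n)%N ->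
          f \in cocycle mu alpha m -> g \in cocycle mu alpha n ->
          bracket_cochain alpha f g \in cocycle mu alpha (m + n).-1
          /\ br m n (cohomology_class mu alpha f) (cohomology_class mu alpha g)
             = ecast d (H d) (bracket_degree n m_ge2)
                 (cohomology_class mu alpha (bracket_cochain alpha f g))
      & is_gerstenhaber cup br].
Proof.
move=> H.
exists (@cohomology_cup K A mu alpha homA).
exists (@cohomology_bracket K A mu alpha homA).
split; last exact: cohomology_gerstenhaber.
- move=> [|[|m]] // [|[|n]] // f g _ _ /(cocycle_on_tuples homA)[F FZ ->].
  move=> /(cocycle_on_tuples homA)[G GZ ->].
  have [[FC _] [GC _]] := (FZ, GZ); rewrite (on_tuples_cup mu FC GC).
  have ZE : (m.+2 + n.+2 = (m.+1 + n.+1).+2)%N by rewrite addSn addnS.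
  have FGZ := opcocycle_cup (hom_operad homA) FZ GZ.
  split; first exact: (on_tuples_cocycle_cast ZE FGZ).
  have Fx : represents m.+1 F (cls mu alpha m.+2 F) by [].
  have Gy : represents n.+1 G (cls mu alpha n.+2 G) by [].
  have FGxy := represents_cls (congr1 Posz ZE) isT FGZ.
  exact: (represents_unique homA (represents_cup homA Fx Gy) FGxy).
- move=> [|[|m]] // [|[|n]] // f g m_ge2 _ /(cocycle_on_tuples homA)[F FZ ->].
  move=> /(cocycle_on_tuples homA)[G GZ ->].
  have [[FC _] [GC _]] := (FZ, GZ); rewrite (on_tuples_bracket FC GC).
  have FGZ := opcocycle_bracket (hom_operad homA) FZ GZ.
  have ZE : ((m.+2 + n.+2).-1 = (m.+1 + n.+1).+1)%N by rewrite addSn addnS.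
  split; first exact: (on_tuples_cocycle_cast ZE FGZ).
  have Fx : represents m.+1 F (cls mu alpha m.+2 F) by [].
  have Gy : represents n.+1 G (cls mu alpha n.+2 G) by [].
  have FGxy := represents_cls (congr1 Posz ZE) isT FGZ.
  exact: (represents_unique homA (represents_bracket homA Fx Gy)
    (represents_cast _ FGxy)).
Qed.
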